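(* There exists a constant $\epsilon_1>0$ such that for all integers $d\ge 0$ and $n\ge d+1$, and for all functions $f:\mathbb{F}_2^n\to\mathbb{F}_2$, $$\Pr[\,T_{\mathrm{GN}}^f \text{ rejects}\,]\;\ge\;\min\{2^{d}\cdot\delta_d(f),\ \epsilon_1\}.$$
   Context: Every function $f:\mathbb{F}_2^n\to\mathbb{F}_2$ is uniquely a multilinear polynomial over $\mathbb{F}_2$; $\deg f$ is its degree. ''Degree $d$ polynomial'' means degree at most $d$. $\mathrm{RM}(d,n)=\{g:\mathbb{F}_2^n\to\mathbb{F}_2 : \deg g\le d\}$. For $f,g:\mathbb{F}_2^n\to\mathbb{F}_2$, $\delta(f,g)=\Pr_{x}[f(x)\ne g(x)]$ with $x$ uniform in $\mathbb{F}_2^n$, and $\delta_d(f)=\min_{g\in \mathrm{RM}(d,n)}\delta(f,g)$. A $k$-flat is a $k$-dimensional affine subspace of $\mathbb{F}_2^n$; the restriction of $f$ to a $k$-flat is viewed as a function on $\mathbb{F}_2^k$ through any affine parametrization (its degree does not depend on the parametrization). The test $T_{\mathrm{GN}}^f$ (with degree parameter $d$) picks a uniformly random $(d+1)$-flat $A\subseteq\mathbb{F}_2^n$ and accepts if and only if $f|_A$ has degree at most $d$; otherwise it rejects. *)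

(* Defs.v *)
From HB Require Import structures.
From mathcomp Require Import all_boot all_order all_algebra.
From mathcomp Require Import reals.
From mathcomp Require Import mpoly.

Set Implicit Arguments.
Unset Strict Implicit.
Unset Printing Implicit Defensive.

Import Order.TTheory GRing.Theory Num.Theory.
Local Open Scope ring_scope.

Definition multilinear (n : nat) (p : {mpoly 'F_2[n]}) : bool :=
  all (fun m : 'X_{1..n} => [forall i, (m i <= 1)%N]) (msupp p).

Definition evalp (n : nat) (p : {mpoly 'F_2[n]}) (x : 'rV['F_2]_n) : 'F_2 :=
  p.@[fun i => x ord0 i].

(* Lagrange interpolation over F_2^n.  The lemmas below show that [mlpoly f] is
   the unique multilinear polynomial that represents [f]. *)
Definition mlpoly (n : nat) (f : 'rV['F_2]_n -> 'F_2) : {mpoly 'F_2[n]} :=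
  \sum_(a : 'rV['F_2]_n)
    f a *: \prod_(i < n) (if a ord0 i == 1 then 'X_i else 1 - 'X_i).

Lemma F2_cases (a : 'F_2) : a = 0 \/ a = 1.
Proof. by case: a => [[|[|k]] // Hk]; [left|right]; apply: val_inj. Qed.

Lemma evalp_mlpoly n (f : 'rV['F_2]_n -> 'F_2) x : evalp (mlpoly f) x = f x.
Proof.
have factorE (a : 'rV['F_2]_n) i :
    (if a ord0 i == 1 then 'X_i else 1 - 'X_i : {mpoly 'F_2[n]}).@[
       fun j => x ord0 j] = (a ord0 i == x ord0 i)%:R.
  case: (F2_cases (a ord0 i)) => ->; case: (F2_cases (x ord0 i)) => E;
    by rewrite E /= ?mevalB ?meval1 mevalXU E ?subrr ?subr0.
rewrite /evalp /mlpoly raddf_sum /= (bigD1 x) //= [X in _ + X]big1 => [|a ax].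
  rewrite mevalZ rmorph_prod /= big1 ?mulr1 ?addr0 // => i _.
  by rewrite factorE eqxx.
rewrite mevalZ rmorph_prod /=.
have [i axi] : exists i, a ord0 i != x ord0 i.
  apply/existsP; move: ax; apply: contraNT; rewrite negb_exists => /forallP h.
  by apply/eqP/rowP => i; apply/eqP; have := h i; rewrite negbK.
by rewrite (bigD1 i) //= factorE (negPf axi) mul0r mulr0.
Qed.

Lemma multilinear_mlpoly n (f : 'rV['F_2]_n -> 'F_2) : multilinear (mlpoly f).
Proof.
apply/allP => m; rewrite /mlpoly => /msupp_sum_le /flatten_mapP[a _].
move=> /msuppZ_le; move: m.
have fac i m : m \in msupp (if a ord0 i == 1 then 'X_i else 1 - 'X_i
                              : {mpoly 'F_2[n]}) ->
    forall j, (m j <= (i == j))%N.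
  case: ifP => _.
    by rewrite msuppX inE => /eqP -> j; rewrite mnmE.
  move=> /msuppB_le; rewrite mem_cat msuppX msupp1 !inE.
  by case/orP => /eqP -> j; rewrite mnmE.
have prodle r m : m \in msupp (\prod_(i <- r)
      (if a ord0 i == 1 then 'X_i else 1 - 'X_i : {mpoly 'F_2[n]})) ->
    forall j, (m j <= count_mem j r)%N.
  elim: r m => [|i r IH] m.
    by rewrite big_nil msupp1 inE => /eqP -> j; rewrite mnmE.
  rewrite big_cons => /msuppM_le /allpairsP[[m1 m2] /= [h1 h2 ->]] j.
  by rewrite mnmE leq_add ?fac ?IH.
move=> m hm; apply/forallP => j; apply: (leq_trans (prodle _ _ hm j)).
by rewrite count_uniq_mem ?index_enum_uniq //; case: (_ \in _).
Qed.

Lemma mlpoly_unique n (f : 'rV['F_2]_n -> 'F_2) (p : {mpoly 'F_2[n]}) :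
  multilinear p -> (forall x, evalp p x = f x) -> p = mlpoly f.
Proof.
move=> mlp pf; apply/eqP; rewrite -subr_eq0; set q := p - _.
have q0 x : evalp q x = 0.
  by rewrite /evalp mevalB -!/(evalp _ _) pf evalp_mlpoly subrr.
have mlq m : m \in msupp q -> forall i, (m i <= 1)%N.
  move=> /msuppB_le; rewrite mem_cat => hm i.
  case/orP: hm => hm; last by move/allP/(_ _ hm)/forallP: (multilinear_mlpoly f).
  by move/allP/(_ _ hm)/forallP: mlp.
apply: contraT => qn0.
have [m0 m0q] : exists m, m \in msupp q.
  move: qn0; rewrite -msupp_eq0; case: (msupp q) => // m s _.
  by exists m; rewrite mem_head.
have [m mq minm] : exists2 m, m \in msupp q &
    forall m', m' \in msupp q -> (mdeg m <= mdeg m')%N.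
  have ex : exists k, has (fun m => mdeg m == k) (msupp q).
    by exists (mdeg m0); apply/hasP; exists m0.
  case: (ex_minnP ex) => k /hasP[m mq /eqP <-] mk; exists m => // m' m'q.
  by apply: mk; apply/hasP; exists m'.
have := q0 (\row_i (m i)%:R); rewrite /evalp mevalE.
rewrite (bigD1_seq m) ?msupp_uniq //= [X in _ + X]big1_seq => [|m' /andP[nm m'q]].
  rewrite addr0 big1 => [|i _]; last first.
    by rewrite mxE; have := mlq _ mq i; case: (m i) => [|[|]].
  by rewrite mulr1 => /eqP; rewrite -[_ == 0]negbK -mcoeff_msupp mq.
have [i hi] : exists i, (m i < m' i)%N.
  apply/existsP; apply: contraNT nm; rewrite negb_exists => /forallP h.
  have le i : (m' i <= m i)%N by rewrite leqNgt.
  have hs : (\sum_i m' i == \sum_i m i)%N.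
    by rewrite eqn_leq leq_sum //= -!mdegE minm.
  apply/eqP/mnmP => i; apply/eqP; rewrite eqn_leq le /= leqNgt.
  apply/negP => lt; move: hs; rewrite (bigD1 i) //= [X in _ == X](bigD1 i) //=.
  rewrite ltn_eqF // -addSn leq_add // leq_sum //.
rewrite (bigD1 i) //= mxE.
have -> : m i = 0%N by have := leq_trans hi (mlq _ m'q i); rewrite ltnS leqn0 => /eqP.
by case: (m' i) hi => // k _; rewrite expr0n /= mul0r mulr0.
Qed.

(* [msize p] is one more than the total degree of [p], and [msize 0 = 0], so the
   zero function gets degree 0. *)
Definition deg (n : nat) (f : 'rV['F_2]_n -> 'F_2) : nat :=
  (msize (mlpoly f)).-1.

Definition RM (d n : nat) : {set {ffun 'rV['F_2]_n -> 'F_2}} :=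
  [set g : {ffun 'rV['F_2]_n -> 'F_2} | (deg g <= d)%N].

Definition dist (R : realType) (n : nat) (f g : 'rV['F_2]_n -> 'F_2) : R :=
  #|[set x | f x != g x]|%:R / #|[set: 'rV['F_2]_n]|%:R.

(* The default value 1 is harmless: [dist] is at most 1 and [RM d n] contains
   the zero function. *)
Definition dist_RM (R : realType) (d n : nat) (f : 'rV['F_2]_n -> 'F_2) : R :=
  \big[Num.min/1]_(g in RM d n) dist R f g.

(* The row space of [U] ranges over all linear subspaces. *)
Definition flats (k n : nat) : {set {set 'rV['F_2]_n}} :=
  [set A : {set 'rV['F_2]_n} | [exists v : 'rV['F_2]_n, exists U : 'M['F_2]_n,
     (\rank U == k) && (A == [set x | (x - v <= U)%MS])]].

Definition affine_map (k n : nat) (v : 'rV['F_2]_n) (B : 'M['F_2]_(k, n))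
  (y : 'rV['F_2]_k) : 'rV['F_2]_n := v + y *m B.

(* A surjection of F_2^k onto a k-flat is bijective by cardinality, so [v] and
   [B] range over the affine parametrizations of [A]. *)
Definition restr_deg_le (d k n : nat) (f : 'rV['F_2]_n -> 'F_2)
  (A : {set 'rV['F_2]_n}) : bool :=
  [exists v : 'rV['F_2]_n, exists B : 'M['F_2]_(k, n),
     ([set affine_map v B y | y : 'rV['F_2]_k] == A) &&
     (deg (f \o affine_map v B) <= d)%N].

Definition GN_accepts (d n : nat) (f : 'rV['F_2]_n -> 'F_2)
  (A : {set 'rV['F_2]_n}) : bool := restr_deg_le d d.+1 f A.

Definition prob_GN_rejects (R : realType) (d n : nat)
  (f : 'rV['F_2]_n -> 'F_2) : R :=
  #|[set A in flats d.+1 n | ~~ GN_accepts d f A]|%:R / #|flats d.+1 n|%:R.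

(* Main.v *)
(* Degree at most [d] is encoded as the vanishing of all [d+1]-fold derivatives,
   and the rejection probability [phi] is computed over injective affine
   parametrizations of [(d+1)]-flats.

   If [f] is within [2^-(d+2)] of a polynomial [P] of degree [d], then a second
   moment estimate shows that a random flat contains exactly one point of
   [f != P], hence rejects, with probability at least [2^d * delta].

   If [f] is far from degree [d], induct on [n], using that [phi f] is the average
   of [phi] over the restrictions of [f] to hyperplanes.  Either all but
   [72 * 2^d] restrictions are still far, and the loss at each step is summable;
   or [f] is close to degree [d] polynomials [P_h] on more than [72 * 2^d]
   hyperplanes.  By the minimum distance of Reed-Muller codes the [P_h] agree on
   intersections; those on [d+2] independent hyperplanes can be stitched together
   to a polynomial [Q] of degree [d], which then agrees with every [P_h].  Almost
   every point lies on at least a third of the hyperplanes (Chebyshev), so [f] is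
   close to [Q], and the first case applies.  In the small dimensions where the
   induction starts, a constant proportion of the restrictions of a function of
   degree more than [d] still has degree more than [d]. *)

Require Import Defs.
From mathcomp Require Import all_boot all_order all_algebra.
From mathcomp Require Import reals.
From mathcomp Require Import mpoly.
From mathcomp Require Import ring lra zify.

Set Implicit Arguments.
Unset Strict Implicit.
Unset Printing Implicit Defensive.

Import Order.TTheory GRing.Theory Num.Theory.
Local Open Scope ring_scope.

Lemma F2_addxx (a : 'F_2) : a + a = 0.
Proof. by case: (F2_cases a) => ->; apply: val_inj. Qed.

Lemma F2_oppr (a : 'F_2) : - a = a.
Proof. by case: (F2_cases a) => ->; apply: val_inj. Qed.

Lemma F2_neq0 (a : 'F_2) : (a != 0) = (a == 1).
Proof. by case: (F2_cases a) => ->. Qed.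

Lemma row_addxx m n (x : 'M['F_2]_(m, n)) : x + x = 0.
Proof. by apply/matrixP => i j; rewrite !mxE F2_addxx. Qed.

Lemma row_oppr m n (x : 'M['F_2]_(m, n)) : - x = x.
Proof. by apply/matrixP => i j; rewrite !mxE F2_oppr. Qed.

(** * Derivatives over [F_2] *)

Definition diff {n : nat} (a : 'rV['F_2]_n) (f : 'rV['F_2]_n -> 'F_2)
  (x : 'rV['F_2]_n) : 'F_2 := f (x + a) - f x.

(* [vanish k f] says that all [k]-fold derivatives of [f] are zero, i.e. that
   [f] has degree less than [k]. *)
Fixpoint vanish {n : nat} (k : nat) (f : 'rV['F_2]_n -> 'F_2) : bool :=
  if k is k'.+1 then [forall a, vanish k' (diff a f)] else [forall x, f x == 0].

Lemma eq_vanish n k (f g : 'rV['F_2]_n -> 'F_2) :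
  f =1 g -> vanish k f = vanish k g.
Proof.
elim: k f g => [|k IH] f g fg /=; apply: eq_forallb => a; first by rewrite fg.
by apply: IH => x; rewrite /diff !fg.
Qed.

Lemma vanishS n k (f : 'rV['F_2]_n -> 'F_2) :
  vanish k.+1 f = [forall a, vanish k (diff a f)].
Proof. by []. Qed.

Lemma vanishD n k (f g : 'rV['F_2]_n -> 'F_2) :
  vanish k f -> vanish k g -> vanish k (fun x => f x + g x).
Proof.
elim: k f g => [|k IH] f g /= /forallP hf /forallP hg; apply/forallP => a.
  by rewrite (eqP (hf a)) (eqP (hg a)) addr0.
rewrite (@eq_vanish _ _ _ (fun x => diff a f x + diff a g x)); first by apply: IH.
by move=> x; rewrite /diff; ring.
Qed.

Lemma vanishB n k (f g : 'rV['F_2]_n -> 'F_2) :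
  vanish k f -> vanish k g -> vanish k (fun x => f x - g x).
Proof.
move=> hf hg; rewrite (@eq_vanish _ _ _ (fun x => f x + g x)) ?vanishD // => x.
by rewrite F2_oppr.
Qed.

Lemma vanish_affine n m k (f : 'rV['F_2]_n -> 'F_2) v (B : 'M_(m, n)) :
  vanish k f -> vanish k (f \o affine_map v B).
Proof.
elim: k f => [|k IH] f /= /forallP hf; apply/forallP => a; first exact: hf.
rewrite (@eq_vanish _ _ _ (diff (a *m B) f \o affine_map v B)) ?IH // => x.
by rewrite /diff /= /affine_map mulmxDl addrA.
Qed.

Lemma vanish_shift n k (f : 'rV['F_2]_n -> 'F_2) a :
  vanish k f -> vanish k (fun x => f (x + a)).
Proof.
move=> /(vanish_affine a 1%:M) h.
rewrite (@eq_vanish _ _ _ (f \o affine_map a 1%:M)) // => x.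
by rewrite /= /affine_map mulmx1 addrC.
Qed.

Lemma vanish_diff n k (f : 'rV['F_2]_n -> 'F_2) a :
  vanish k f -> vanish k (diff a f).
Proof. by move=> hf; apply: vanishB => //; apply: vanish_shift. Qed.

Lemma vanish_leq n k l (f : 'rV['F_2]_n -> 'F_2) :
  (k <= l)%N -> vanish k f -> vanish l f.
Proof.
move=> /subnK <-; elim: (l - k)%N => [|i IH] //= hf.
by apply/forallP => a; apply: vanish_diff; apply: IH.
Qed.

Lemma vanish0 n k : vanish k (fun _ : 'rV['F_2]_n => 0).
Proof. by apply: (@vanish_leq _ 0) => //; apply/forallP => x. Qed.

(** Leibniz rule: the derivative of [l * f] along [a] is a constant times a translate of [f], plus
    [l] times a derivative of [f], so induction on [k] applies. *)
Lemma vanish_mul_affine n k (l f : 'rV['F_2]_n -> 'F_2) :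
  (forall a x y, diff a l x = diff a l y) ->
  vanish k f -> vanish k.+1 (fun x => l x * f x).
Proof.
move=> hl; elim: k f => [|k IH] f hf.
  rewrite (@eq_vanish _ _ _ (fun=> 0)) ?vanish0 // => x.
  by move/forallP/(_ x)/eqP: hf => ->; rewrite mulr0.
rewrite vanishS; apply/forallP => a.
rewrite (@eq_vanish _ _ _ (fun x => diff a l 0 * f (x + a) + l x * diff a f x)).
  apply: vanishD; last by apply: IH; apply: (forallP hf).
  case: (F2_cases (diff a l 0)) => ->.
    by rewrite (@eq_vanish _ _ _ (fun=> 0)) ?vanish0 // => x; rewrite mul0r.
  rewrite (@eq_vanish _ _ _ (fun x => f (x + a))) ?vanish_shift // => x.
  by rewrite mul1r.
by move=> x; rewrite (hl a 0 x) /diff; ring.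
Qed.

Lemma card_support_shift n (f : 'rV['F_2]_n -> 'F_2) a :
  #|[set x | f (x + a) != 0]| = #|[set x | f x != 0]|.
Proof.
rewrite -(card_preimset [set x | f x != 0] (addIr a)).
by apply: eq_card => x; rewrite !inE.
Qed.

(* Some derivative of a nonconstant [f] is nonzero, and its support is at most
   twice as large as that of [f]. *)
Lemma vanish_support n k (f : 'rV['F_2]_n -> 'F_2) x0 :
  vanish k.+1 f -> f x0 != 0 -> (2 ^ n <= 2 ^ k * #|[set x | (f x != 0)%R]|)%N.
Proof.
elim: k f x0 => [|k IH] f x0 hf fx0.
  have -> : [set x | f x != 0] = setT.
    apply/setP => x; rewrite !inE; move/forallP/(_ (x - x0)): hf.
    move=> /forallP/(_ x0); rewrite /diff [x0 + _]addrC subrK subr_eq0.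
    by move=> /eqP ->; rewrite fx0.
  by rewrite cardsT card_mx mul1n card_Fp ?mul1n.
have [/existsP[a /existsP[x fax]]|nex] :=
    boolP [exists a, exists x, diff a f x != 0].
  have := IH _ x (forallP hf a) fax; rewrite expnSr -mulnA => h.
  apply: (leq_trans h); rewrite leq_mul2l mul2n -addnn.
  rewrite -{1}(card_support_shift f a) orbC (leq_trans _ (leq_card_setU _ _)) //.
  apply/subset_leq_card/subsetP => y; rewrite !inE /diff.
  by apply: contraNT; rewrite negb_or !negbK => /andP[/eqP-> /eqP->]; rewrite subr0.
have h1 : vanish 1 f.
  apply/forallP => a; apply/forallP => x; apply: contraNT nex => h.
  by apply/existsP; exists a; apply/existsP; exists x.
apply: (leq_trans (IH f x0 (vanish_leq _ h1) fx0)) => //.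
by rewrite leq_mul2r leq_exp2l ?leqnSn ?orbT.
Qed.

(** * Sums over flats *)

(** Translation by [a] pairs the points, and paired values cancel in characteristic 2. A coordinate
    where [a] is 1 selects one point of each pair. *)
Lemma sum_invariant n (a : 'rV['F_2]_n) (g : 'rV['F_2]_n -> 'F_2) :
  a != 0 -> (forall y, g (y + a) = g y) -> \sum_y g y = 0.
Proof.
move=> a0 hg; have [i ai] : exists i, a ord0 i == 1.
  apply/existsP; apply: contraNT a0; rewrite negb_exists => /forallP h.
  by apply/eqP/rowP => i; have := h i; rewrite -F2_neq0 negbK mxE => /eqP.
rewrite (bigID (fun y : 'rV_n => y ord0 i == 0)) /=.
rewrite [X in _ + X](reindex_inj (addIr a)) /=.
rewrite [X in _ + X](eq_big (fun y : 'rV_n => y ord0 i == 0) g) => [|y|y _].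
- exact: F2_addxx.
- by rewrite mxE (eqP ai); case: (F2_cases (y ord0 i)) => ->.
- exact: hg.
Qed.

Lemma sum_rVS k (g : 'rV['F_2]_(1 + k) -> 'F_2) :
  \sum_y g y = \sum_y (g (row_mx 0 y) + g (row_mx 1%:M y)).
Proof.
rewrite (reindex (fun p : 'F_2 * 'rV['F_2]_k => row_mx p.1%:M p.2)) /=; last first.
  exists (fun y => (lsubmx y ord0 ord0, rsubmx y)) => [[t y] _|y _] /=.
    by rewrite row_mxKl row_mxKr mxE.
  by rewrite -mx11_scalar hsubmxK.
rewrite -(pair_bigA _ (fun t y => g (row_mx t%:M y))) /=.
rewrite !big_ord_recl big_ord0 addr0 -big_split /=; apply: eq_bigr => y _.
by rewrite raddf0; congr (_ + g (row_mx _%:M _)); apply: val_inj.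
Qed.

(** The row [b] splits the flat into two translates, whose contributions add up to a derivative
    along [b]. Iterating, a sum over a [k]-flat is a [k]-fold derivative. *)
Lemma sum_flatS n k (f : 'rV['F_2]_n -> 'F_2) v b (B : 'M['F_2]_(k, n)) :
  \sum_y f (affine_map v (col_mx b B : 'M_(1 + k, n)) y) =
  \sum_y diff b f (affine_map v B y).
Proof.
rewrite sum_rVS; apply: eq_bigr => y _.
rewrite /affine_map !mul_row_col mul0mx mul1mx add0r /diff F2_oppr addrC.
by rewrite [b + _]addrC addrA.
Qed.

Lemma sum_vanish n k (f : 'rV['F_2]_n -> 'F_2) v (B : 'M['F_2]_(k, n)) :
  vanish k f -> \sum_y f (affine_map v B y) = 0.
Proof.
elim: k f B => [|k IH] f B hf.
  by apply: big1 => y _; apply/eqP/(forallP hf).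
rewrite -[B](@vsubmxK _ 1 k) (sum_flatS f v) IH //; exact: (forallP hf).
Qed.

Lemma vanish_sum n k (f : 'rV['F_2]_n -> 'F_2) :
  (forall v (B : 'M['F_2]_(k, n)), \sum_y f (affine_map v B y) = 0) ->
  vanish k f.
Proof.
elim: k f => [|k IH] f hf.
  apply/forallP => x; have := hf x 0; rewrite (bigD1 0) //= big1 => [|y].
    by rewrite /affine_map mul0mx !addr0 => /eqP.
  by rewrite thinmx0 eqxx.
rewrite vanishS; apply/forallP => a; apply: IH => v B.
by rewrite -sum_flatS.
Qed.

Lemma sum_not_row_free n k (f : 'rV['F_2]_n -> 'F_2) v (B : 'M['F_2]_(k, n)) :
  ~~ row_free B -> \sum_y f (affine_map v B y) = 0.
Proof.
rewrite -kermx_eq0 => /rowV0Pn[y0 /sub_kermxP y0B y00].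
by apply: (sum_invariant y00) => y; rewrite /affine_map mulmxDl y0B addr0.
Qed.

(** * Degree of the multilinear polynomial *)

(** A monomial of degree at most [d] misses one of the [d+1] variables, and flipping that variable
    pairs off its values. *)
Lemma sum_deg_lt d (g : 'rV['F_2]_d.+1 -> 'F_2) :
  (deg g <= d)%N -> \sum_y g y = 0.
Proof.
move=> dg.
under eq_bigr do rewrite -(evalp_mlpoly g) /evalp mevalE.
rewrite exchange_big /=; apply: big1_seq => m /andP[_ mp].
rewrite -big_distrr /=.
have dm : (mdeg m <= d)%N.
  have := msize_mdeg_lt mp; move: dg; rewrite /deg.
  by case: (msize _) => // k; rewrite ltnS /= => kd mk; apply: leq_trans kd.
have [i /eqP mi] : exists i, m i == 0%N.
  apply/existsP; apply: contraLR dm; rewrite negb_exists -ltnNge => /forallP h.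
  rewrite mdegE -[X in (X <= _)%N](card_ord d.+1) -sum1_card leq_sum // => i _.
  by rewrite lt0n.
rewrite (@sum_invariant _ (delta_mx ord0 i)) ?mulr0 // => [|y].
  by apply/eqP => /rowP/(_ i); rewrite !mxE !eqxx.
apply: eq_bigr => j _; rewrite !mxE eqxx /=.
by case: eqP => [->|_]; rewrite ?mi ?addr0.
Qed.

(** For a monomial [m] of degree above [d], the sum of [f] over the coordinate subspace of the
    variables of [m] is the coefficient of [m]; but that sum is zero by [sum_vanish]. *)
Lemma deg_vanish n d (f : 'rV['F_2]_n -> 'F_2) :
  vanish d.+1 f -> (deg f <= d)%N.
Proof.
move=> hf; rewrite /deg -subn1 leq_subLR add1n msizeE.
apply/bigmax_leqP_seq => m mp _; rewrite ltnS leqNgt; apply/negP => dm.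
have ml m' i : m' \in msupp (mlpoly f) -> (m' i <= 1)%N.
  by move=> h; move/allP/(_ _ h)/forallP: (multilinear_mlpoly f).
pose S := [set i | m i == 1%N].
have mE i : m i = (i \in S) by rewrite inE; case: (m i) (ml m i mp) => [|[]].
have cS : mdeg m = #|S|.
  by rewrite mdegE -sum1_card [RHS]big_mkcond; apply: eq_bigr => i _.
pose B : 'M['F_2]_(#|S|, n) := \matrix_(j, i) (i == enum_val j)%:R.
have BS (y : 'rV_#|S|) j : (y *m B) ord0 (enum_val j) = y ord0 j.
  rewrite !mxE (bigD1 j) //= mxE eqxx mulr1 big1 ?addr0 // => l lj.
  by rewrite mxE (inj_eq enum_val_inj) eq_sym (negPf lj) mulr0.
have BnS (y : 'rV_#|S|) i : i \notin S -> (y *m B) ord0 i = 0.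
  move=> iS; rewrite !mxE big1 // => l _; rewrite mxE; case: eqP => [il|_].
    by rewrite il enum_valP in iS.
  by rewrite mulr0.
have dS : (d < #|S|)%N by rewrite -cS.
have := sum_vanish 0 B (vanish_leq dS hf).
under eq_bigr do rewrite -(evalp_mlpoly f) /evalp mevalE /affine_map add0r.
rewrite exchange_big /= (bigD1_seq m) ?msupp_uniq //=.
rewrite [X in _ + X]big1_seq => [|m' /andP[nm m'p]]; rewrite -big_distrr /=.
  rewrite addr0 (bigD1 (const_mx 1)) //= [X in _ + X]big1 => [|y ny].
    rewrite big1 => [|i _]; last first.
      rewrite mE; have [iS|] := boolP (i \in S); last by rewrite expr0.
      by rewrite -(enum_rankK_in iS iS) BS mxE expr1n.
    by rewrite addr0 mulr1 => /eqP; rewrite -[_ == 0]negbK -mcoeff_msupp mp.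
  have [j yj] : exists j, y ord0 j == 0.
    apply/existsP; apply: contraNT ny; rewrite negb_exists => /forallP h.
    by apply/eqP/rowP => j; rewrite mxE; apply/eqP; rewrite -F2_neq0.
  rewrite (bigD1 (enum_val j)) //= BS (eqP yj) mE enum_valP.
  by rewrite expr1 mul0r.
(* A monomial [m'] other than [m] either misses a variable of [S], and its values cancel in pairs,
   or contains a variable outside [S], which is zero on the subspace. *)
have [/existsP[i /andP[iS /eqP mi]]|nex] :=
    boolP [exists i, (i \in S) && (m' i == 0%N)].
  rewrite (@sum_invariant _ (delta_mx ord0 (enum_rank_in iS i))) ?mulr0 // => [|y].
    by apply/eqP => /rowP/(_ (enum_rank_in iS i)); rewrite !mxE !eqxx.
  apply: eq_bigr => l _; have [->|li] := eqVneq l i; first by rewrite mi.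
  have [lS|lS] := boolP (l \in S); last by rewrite !BnS.
  rewrite -(enum_rankK_in lS lS) !BS !mxE eqxx /=.
  have -> : (enum_rank_in lS l == enum_rank_in iS i) = false; last by rewrite addr0.
  apply/negP => /eqP/(congr1 enum_val).
  by rewrite !enum_rankK_in // => /eqP; rewrite (negPf li).
have [l lS ml1] : exists2 l, l \notin S & m' l != 0%N.
  apply/exists_inP; apply: contraNT nm.
  rewrite negb_exists_in => /forall_inP h.
  apply/eqP/mnmP => l; rewrite mE; have [lS|lS] := boolP (l \in S).
    move: nex; rewrite negb_exists => /forallP/(_ l); rewrite lS /=.
    by have := ml m' l m'p; case: (m' l) => [|[]].
  by have := h l lS; rewrite negbK => /eqP.
rewrite big1 ?mulr0 // => y _; rewrite (bigD1 l) //= BnS //.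
by rewrite expr0n (negPf ml1) mul0r.
Qed.

(** * Affine hyperplanes *)

Definition dot {n : nat} (x : 'rV['F_2]_n) (L : 'cV['F_2]_n) : 'F_2 :=
  (x *m L) ord0 ord0.

(* The pair [(L, c)] stands for the affine hyperplane [L x = c]; it is a genuine
   hyperplane only if [L != 0]. *)
Definition hyp (n : nat) : Type := ('cV['F_2]_n * 'F_2)%type.

Definition on_hyp {n : nat} (h : hyp n) (x : 'rV['F_2]_n) : bool :=
  dot x h.1 == h.2.

Lemma dotDl n (x y : 'rV['F_2]_n) L : dot (x + y) L = dot x L + dot y L.
Proof. by rewrite /dot mulmxDl mxE. Qed.

Lemma dotDr n (x : 'rV['F_2]_n) L M : dot x (L + M) = dot x L + dot x M.
Proof. by rewrite /dot mulmxDr mxE. Qed.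

Lemma dotZl n (x : 'rV['F_2]_n) a L : dot (a *: x) L = a * dot x L.
Proof. by rewrite /dot -scalemxAl mxE. Qed.

Lemma dotZr n (x : 'rV['F_2]_n) a L : dot x (a *: L) = a * dot x L.
Proof. by rewrite /dot -scalemxAr mxE. Qed.

Lemma dot_neq0 n (L : 'cV['F_2]_n) : L != 0 -> exists e, dot e L = 1.
Proof.
move=> L0; have [i] : exists i, L i ord0 != 0.
  apply/existsP; apply: contraNT L0; rewrite negb_exists => /forallP h.
  apply/eqP/matrixP => i j; rewrite ord1 mxE.
  by apply/eqP; have := h i; rewrite negbK.
rewrite F2_neq0 => /eqP Li; exists (delta_mx ord0 i).
by rewrite /dot -rowE mxE.
Qed.

Lemma hyp_eqF n (h : hyp n) x : ~~ on_hyp h x -> dot x h.1 = h.2 + 1.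
Proof.
rewrite /on_hyp; case: (F2_cases (dot x h.1)) => ->;
  case: (F2_cases h.2) => -> //= _; exact: val_inj.
Qed.

Lemma on_hyp_shift n (h : hyp n) x e :
  dot e h.1 = 0 -> on_hyp h (x + e) = on_hyp h x.
Proof. by rewrite /on_hyp dotDl => ->; rewrite addr0. Qed.

Lemma on_hyp_flip n (h : hyp n) x e :
  dot e h.1 = 1 -> on_hyp h (x + e) = ~~ on_hyp h x.
Proof.
rewrite /on_hyp dotDl => ->; case: (F2_cases (dot x h.1)) => ->;
  by case: (F2_cases h.2) => ->.
Qed.

Lemma vanish_on_hyp n k (h : hyp n) (f : 'rV['F_2]_n -> 'F_2) :
  vanish k f -> vanish k.+1 (fun x => (on_hyp h x)%:R * f x).
Proof.
apply: vanish_mul_affine => a x y.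
have E z : (on_hyp h z)%:R = dot z h.1 + h.2 + 1 :> 'F_2.
  rewrite /on_hyp; case: (F2_cases (dot z h.1)) => ->;
    case: (F2_cases h.2) => -> //=; exact: val_inj.
by rewrite /diff !E !dotDl; ring.
Qed.

(** * Independent hyperplanes and stitching *)

(** Linear independence of the normals, stated through a direction that crosses [h] and is parallel
    to all later hyperplanes, since the inductions move along this direction. *)
Fixpoint indep {n : nat} (s : seq (hyp n)) : bool :=
  if s is h :: s' then
    [exists e, (dot e h.1 == 1) && all (fun h' => dot e h'.1 == 0) s'] && indep s'
  else true.

(** Translation by [e] swaps the two sides of [h] and keeps the sides of the other hyperplanes, so
    each hyperplane halves the set. *)
Lemma card_outside n (s : seq (hyp n)) : indep s ->
  (2 ^ size s * #|[set x | all (fun h => ~~ on_hyp h x) s]| = 2 ^ n)%N.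
Proof.
elim: s => [_|h s IH /= /andP[/existsP[e /andP[/eqP eh /allP es]] /IH <-]].
  rewrite mul1n; have -> : [set x : 'rV['F_2]_n |
      all (fun h => ~~ on_hyp h x) [::]] = setT.
    by apply/setP => x; rewrite !inE.
  by rewrite cardsT card_mx mul1n card_Fp.
rewrite expnSr -mulnA; congr (_ * _)%N.
set A := [set x | all _ s].
have AE x : (x + e \in A) = (x \in A).
  rewrite !inE; apply: eq_in_all => h' h's.
  by rewrite on_hyp_shift //; apply/eqP/es.
rewrite -(cardsID [set x | on_hyp h x] A) mul2n -addnn; congr (_ + _)%N.
  rewrite -(card_preimset (A :&: _) (addIr e)).
  apply: eq_card => x; rewrite [in RHS]inE [in RHS]in_setI AE !inE.
  by rewrite on_hyp_flip // andbC.
by apply: eq_card => x; rewrite !inE.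
Qed.

(** The linear span of the normals, as the annihilator of their common kernel. *)
Definition span {n : nat} (s : seq (hyp n)) : {set 'cV['F_2]_n} :=
  [set L | [forall e, all (fun h => dot e h.1 == 0) s ==> (dot e L == 0)]].

Lemma card_span n (s : seq (hyp n)) : indep s -> (#|span s| <= 2 ^ size s)%N.
Proof.
elim: s => [_|h s IH /= /andP[/existsP[e0 /andP[/eqP eh /allP es]] /IH le]].
  suff sub : span [::] \subset [set (0 : 'cV['F_2]_n)].
    by apply: (leq_trans (subset_leq_card sub)); rewrite cards1.
  apply/subsetP => L.
  rewrite !inE; apply: contraLR => /dot_neq0[e eL].
  by rewrite negb_forall; apply/existsP; exists e; rewrite /= eL.
have sub : span (h :: s) \subset
    span s :|: [set L + h.1 | L in span s].
  apply/subsetP => L; rewrite inE => /forallP hL.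
  (* Removing the [h.1]-component of [L], read off by [e0], leaves an element of [span s]; thus each
     new normal at most doubles the span. *)
  have key : L + dot e0 L *: h.1 \in span s.
    rewrite inE; apply/forallP => e; apply/implyP => /allP ea.
    have := hL (e + dot e h.1 *: e0); rewrite /= !dotDl !dotZl eh mulr1 F2_addxx.
    rewrite eqxx /= dotDr dotZr [_ * dot e h.1]mulrC => /implyP; apply.
    apply/allP => h' h's; rewrite dotDl dotZl (eqP (ea _ h's)).
    by rewrite (eqP (es _ h's)) mulr0 addr0.
  rewrite inE; case: (F2_cases (dot e0 L)) key => ->.
    by rewrite scale0r addr0 => ->.
  rewrite scale1r => key; apply/orP; right; apply/imsetP.
  exists (L + h.1) => //; rewrite -addrA.
  suff -> : h.1 + h.1 = 0 by rewrite addr0.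
  exact: row_addxx.
apply: (leq_trans (subset_leq_card sub)).
apply: (leq_trans (leq_card_setU _ _)).
rewrite expnS mul2n -addnn leq_add //.
by apply: leq_trans le; exact: leq_imset_card.
Qed.

(** Greedy choice: [l] independent hyperplanes span at most [2^l] normals, each carried by two
    hyperplanes, so among more than [2^(l+1)] hyperplanes some normal lies outside the span. *)
Lemma indep_subset n l (H : {set hyp n}) : (2 ^ l < #|H|)%N ->
  exists s, [/\ size s = l, indep s & {subset s <= H}].
Proof.
elim: l => [|l IH] lH; first by exists [::].
have [|s [sz si sH]] := IH; first by apply: leq_ltn_trans lH; rewrite leq_exp2l.
have [h hH hs] : exists2 h, h \in H & h.1 \notin span s.
  apply/exists_inP; apply: contraTT lH.
  rewrite negb_exists_in -leqNgt => /forall_inP hH.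
  have sub : H \subset setX (span s) [set: 'F_2].
    apply/subsetP => -[L c] /hH; rewrite negbK => /= Ls.
    by rewrite in_setX Ls in_setT.
  apply: (leq_trans (subset_leq_card sub)).
  by rewrite cardsX cardsT card_Fp // expnSr leq_mul2r -sz card_span.
exists (h :: s); split => /=; first by rewrite sz.
  rewrite si andbT; move: hs; rewrite inE negb_forall => /existsP[e].
  rewrite negb_imply F2_neq0 => /andP[es eh].
  by apply/existsP; exists e; rewrite eh.
by move=> h'; rewrite inE => /orP[/eqP->|/sH].
Qed.

(* To add a hyperplane [h], correct the polynomial [Q] stitched so far by
   [P h - Q] composed with the projection onto [h] along a direction parallel to
   all the previous hyperplanes. *)
Lemma stitch n k (s : seq (hyp n)) (P : hyp n -> 'rV['F_2]_n -> 'F_2) :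
  indep s -> {in s, forall h, vanish k (P h)} ->
  {in s &, forall h h', forall x, on_hyp h x -> on_hyp h' x -> P h x = P h' x} ->
  exists Q : {ffun 'rV['F_2]_n -> 'F_2}, vanish k Q /\
    {in s, forall h, forall x, on_hyp h x -> Q x = P h x}.
Proof.
elim: s => [_ _ _|h s IH /= /andP[/existsP[e /andP[/eqP eh /allP es]] si] vP cP].
  exists [ffun=> 0]; split=> //; rewrite (@eq_vanish _ _ _ (fun=> 0)) ?vanish0 //.
  by move=> x; rewrite ffunE.
have [|h1 h2 h1s h2s|Q [vQ QE]] := IH si.
- by move=> h' h's; apply: vP; rewrite inE h's orbT.
- by apply: cP; rewrite inE ?h1s ?h2s orbT.
pose pr := affine_map (h.2 *: e) (1%:M + h.1 *m e).
have prE x : pr x = x + (dot x h.1 + h.2) *: e.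
  rewrite /pr /affine_map mulmxDr mulmx1 mulmxA [x *m h.1]mx11_scalar.
  by rewrite mul_scalar_mx scalerDl addrC -addrA.
pose Q' := [ffun x => Q x + (P h (pr x) - Q (pr x))]; exists Q'; split.
  rewrite (@eq_vanish _ _ _ (fun x => Q x + (P h (pr x) - Q (pr x)))).
    apply: vanishD => //.
    apply: (vanishB (f := P h \o pr) (g := Q \o pr)); apply: vanish_affine => //.
    by apply: vP; rewrite mem_head.
  by move=> x; rewrite ffunE.
have prh x : on_hyp h (pr x).
  rewrite /on_hyp prE dotDl dotZl eh mulr1 addrA F2_addxx add0r.
  by [].
move=> h'; rewrite inE => /orP[/eqP-> x hx|h's x hx]; rewrite ffunE.
  rewrite prE (eqP hx) F2_addxx scale0r addr0; ring.
have h'p : on_hyp h' (pr x).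
  by rewrite prE on_hyp_shift // dotZl (eqP (es _ h's)) mulr0.
rewrite (QE _ h's _ h'p) (cP h h' _ _ _ (prh x) h'p) ?mem_head ?inE ?h's ?orbT //.
by rewrite subrr addr0 (QE _ h's _ hx).
Qed.

(** * Points covered by many hyperplanes *)

Definition sign_hyp {n : nat} (h : hyp n) (x : 'rV['F_2]_n) : int :=
  if on_hyp h x then 1 else -1.

(* The signs of distinct hyperplanes are orthogonal, or opposite if the
   hyperplanes are parallel. *)
Lemma sum_sign_hyp n (h h' : hyp n) : h != h' ->
  \sum_x sign_hyp h x * sign_hyp h' x <= 0.
Proof.
move=> hh'; have [L0|/dot_neq0[e eh]] := eqVneq (h.1 + h'.1) 0.
  apply: sumr_le0 => x _.
  have : dot x h.1 + dot x h'.1 = 0 by rewrite -dotDr L0 /dot mulmx0 mxE.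
  have : h.2 != h'.2.
    move: L0 hh'; case: (h) (h') => [L c] [M c'] /= LM.
    have -> : L = M by apply/eqP; rewrite -subr_eq0 -LM (_ : - M = M) //;
      apply/matrixP => i j; rewrite mxE F2_oppr.
    by apply: contraNneq => ->.
  rewrite /sign_hyp /on_hyp.
  case: (F2_cases (dot x h.1)) => ->; case: (F2_cases (dot x h'.1)) => -> //=;
  by case: (F2_cases h.2) => ->; case: (F2_cases h'.2) => ->.
have flip x : sign_hyp h (x + e) * sign_hyp h' (x + e) =
    - (sign_hyp h x * sign_hyp h' x).
  move: eh; rewrite dotDr /sign_hyp.
  case: (F2_cases (dot e h.1)) => eh; case: (F2_cases (dot e h'.1)) => eh';
    rewrite eh eh' => // _.
    by rewrite (on_hyp_shift x eh) (on_hyp_flip x eh'); do 2!case: on_hyp.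
  by rewrite (on_hyp_flip x eh) (on_hyp_shift x eh'); do 2!case: on_hyp.
have : \sum_x sign_hyp h x * sign_hyp h' x = - \sum_x sign_hyp h x * sign_hyp h' x.
  rewrite [LHS](reindex_inj (addIr e)) /= -sumrN.
  by apply: eq_bigr => x _; rewrite flip.
lia.
Qed.

Lemma sum_sqr_sign n (H : {set hyp n}) :
  \sum_x (\sum_(h in H) sign_hyp h x) ^+ 2 <= (#|H| * 2 ^ n)%:R.
Proof.
under eq_bigr do rewrite expr2 big_distrlr /=.
rewrite exchange_big /= natrM mulr_natl -sumr_const; apply: ler_sum => h hH.
rewrite exchange_big (bigD1 h) //= -[X in _ <= X]addr0 lerD //.
  rewrite (eq_bigr (fun=> 1)) => [|x _].
    by rewrite sumr_const card_mx card_Fp // mul1n.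
  by rewrite /sign_hyp; case: on_hyp.
by apply: sumr_le0 => h' /andP[_ h'h]; rewrite sum_sign_hyp // eq_sym.
Qed.

(** Chebyshev: at a point on fewer than a third of the [K] hyperplanes the signs add up to less than
    [-K/3], so the square of the sum exceeds [K^2/9], while [sum_sqr_sign] bounds the total of the
    squares. *)
Lemma card_rarely_covered n (H : {set hyp n}) :
  (#|H| * #|[set x | 3 * #|[set h in H | on_hyp h x]| < #|H|]| <= 9 * 2 ^ n)%N.
Proof.
set K := #|H|; set A := [set x | _]; have [K0|K0] := posnP K.
  by rewrite K0 mul0n.
rewrite -(leq_pmul2l K0) -(ler_nat int).
have signE x : \sum_(h in H) sign_hyp h x =
    2 * #|[set h in H | on_hyp h x]|%:R - K%:R.
  rewrite /K -!sum1_card !natr_sum big_distrr /=.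
  rewrite [X in X - _](eq_bigl (fun h => (h \in H) && on_hyp h x));
    last by move=> h; rewrite inE.
  rewrite big_mkcondr /= -sumrB; apply: eq_bigr => h _.
  by rewrite /sign_hyp; case: on_hyp.
have big_sqr x : x \in A -> (K * K)%:R <= 9 * (\sum_(h in H) sign_hyp h x) ^+ 2.
  rewrite inE signE => lt.
  have : 3 * #|[set h in H | on_hyp h x]|%:R < K%:R :> int.
    by rewrite -natrM ltr_nat.
  rewrite natrM; set a := _%:R; set b := (K%:R : int) => ab.
  have a0 : 0 <= a by rewrite ler0n.
  nia.
have le : ((K * K) * #|A|)%:R <= 9 * \sum_x (\sum_(h in H) sign_hyp h x) ^+ 2.
  rewrite natrM mulr_natr -sumr_const (le_trans (ler_sum _ big_sqr)) //.
  rewrite -big_distrr /= ler_wpM2l // [X in _ <= X](bigID (mem A)) /= lerDl.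
  by apply: sumr_ge0 => x _; apply: sqr_ge0.
rewrite mulnA (le_trans le) // mulnCA natrM ler_wpM2l //; exact: sum_sqr_sign.
Qed.

(** Incidences between [H] and [D] are counted twice: a point of [D] that is not rarely covered lies
    on at least a third of [H], and each hyperplane contains at most [b] points of [D]. *)
Lemma close_of_cover n (H : {set hyp n}) (D : {set 'rV['F_2]_n}) b :
  {in H, forall h, (#|[set x in D | on_hyp h x]| <= b)%N} ->
  (#|H| * #|D| <= 3 * b * #|H| + 9 * 2 ^ n)%N.
Proof.
move=> hb; set A := [set x | (3 * #|[set h in H | on_hyp h x]| < #|H|)%N].
rewrite -(cardsID A D) mulnDr addnC leq_add //; last first.
  apply: leq_trans (card_rarely_covered H).
  by rewrite leq_mul2l (subset_leq_card (subsetIr _ _)) orbT.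
apply: (@leq_trans (\sum_(x in D) 3 * #|[set h in H | on_hyp h x]|)%N).
  rewrite mulnC -sum_nat_const [X in (_ <= X)%N](bigID (mem A)) /=.
  apply: leq_trans (leq_addl _ _).
  rewrite (eq_bigl (fun x => (x \in D) && (x \notin A))); last first.
    by move=> x; rewrite inE andbC.
  by apply: leq_sum => x /andP[_]; rewrite inE -leqNgt.
rewrite -big_distrr /= -mulnA leq_mul2l /=.
under eq_bigr do rewrite -sum1dep_card big_mkcondr /=.
rewrite exchange_big /= mulnC -sum_nat_const.
apply: leq_sum => h /hb; apply: leq_trans.
by rewrite -sum1dep_card big_mkcondr.
Qed.

(** * Polynomials close to [f] on hyperplanes *)

Definition close {n : nat} (d : nat) (f : 'rV['F_2]_n -> 'F_2) (b : nat)
    (h : hyp n) (P : {ffun 'rV['F_2]_n -> 'F_2}) : bool :=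
  vanish d.+1 P && (#|[set x | on_hyp h x && (f x != P x)]| <= b)%N.

(* The difference, cut off to both hyperplanes, has degree at most [d+2]. *)
Lemma close_consistent n d (f : 'rV['F_2]_n -> 'F_2) b h h' P P' x :
  close d f b h P -> close d f b h' P' -> (2 ^ d.+2 * (b + b) < 2 ^ n)%N ->
  on_hyp h x -> on_hyp h' x -> P x = P' x.
Proof.
move=> /andP[vP cP] /andP[vP' cP'] lt hx h'x; apply/eqP; apply: contraTT lt.
rewrite -subr_eq0 -leqNgt => PP'.
pose g y := (on_hyp h y)%:R * ((on_hyp h' y)%:R * (P y - P' y)).
have vg : vanish d.+3 g by do 2!apply: vanish_on_hyp; apply: vanishB.
have gx : g x != 0 by rewrite /g hx h'x !mul1r.
apply: (leq_trans (vanish_support vg gx)); rewrite leq_mul2l.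
rewrite orbC (leq_trans _ (leq_add cP cP')) //.
apply: (leq_trans _ (leq_card_setU _ _)).
apply/subset_leq_card/subsetP => y; rewrite !inE /g.
do 2![case: on_hyp; rewrite /= ?mul0r ?mulr0 ?mul1r ?eqxx //].
by apply: contraNT; rewrite negb_or !negbK => /andP[/eqP<- /eqP<-]; rewrite subrr.
Qed.

Lemma close_stitch n d (f : 'rV['F_2]_n -> 'F_2) b (H : {set hyp n}) l :
  {in H, forall h, exists P, close d f b h P} ->
  (2 ^ d.+2 * (b + b) < 2 ^ n)%N -> (2 ^ l < #|H|)%N ->
  exists Q P s, [/\ vanish d.+1 Q, {in H, forall h, close d f b h (P h)},
    indep s & size s = l /\ {subset s <= H} /\
    {in s, forall h, forall x, on_hyp h x -> Q x = P h x}].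
Proof.
move=> hH lt /indep_subset[s [sl si sH]].
pose P h := odflt [ffun=> 0] [pick P | close d f b h P].
have cP : {in H, forall h, close d f b h (P h)}.
  by move=> h /hH[P0 hP0]; rewrite /P; case: pickP => // /(_ P0); rewrite hP0.
have [|h h' hs h's x|Q [vQ QE]] := @stitch _ d.+1 s (fun h => P h) si.
- by move=> h /sH/cP/andP[].
- by apply: close_consistent lt; apply/cP/sH.
by exists Q, (fun h => P h), s; split.
Qed.

(** * Averaging over restrictions to hyperplanes *)

(** The fibres of a surjective homomorphism are translates of each other. *)
Lemma card_fiber a b c d (g : 'M['F_2]_(a, b) -> 'M['F_2]_(c, d)) w :
  {morph g : x y / x + y} -> (forall u, exists x, g x = u) ->
  (2 ^ (c * d) * #|[set x | g x == w]| = 2 ^ (a * b))%N.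
Proof.
move=> gD gs.
have <- : #|'M['F_2]_(a, b)| = (2 ^ (a * b))%N by rewrite card_mx card_Fp.
have <- : #|'M['F_2]_(c, d)| = (2 ^ (c * d))%N by rewrite card_mx card_Fp.
rewrite -[RHS]sum1_card (partition_big g predT) //= -sum_nat_const.
apply: eq_bigr => u _; rewrite sum1dep_card; have [x0 gx0] := gs (u + w).
rewrite -(card_preimset [set x | g x == w] (addIr x0)).
apply: eq_card => x; rewrite !inE gD gx0 addrA.
by rewrite -[LHS]subr_eq0 addrK addr_eq0 row_oppr.
Qed.

Lemma card_row_free_ker n k (B : 'M['F_2]_(k, n)) : row_free B ->
  (2 ^ k * #|[set L : 'cV['F_2]_n | B *m L == 0%R]| = 2 ^ n)%N.
Proof.
move=> fB; rewrite -[k in (2 ^ k)%N]muln1 -[n in RHS]muln1.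
apply: card_fiber => [x y|u]; first by rewrite mulmxDr.
by exists (pinvmx B *m u); rewrite mulmxA mulmxVp // mul1mx.
Qed.

(** [q] parametrizes the hyperplane [h], and [D] inverts its linear part [q.2]: on one side
    everywhere, on the other side along the directions of [h]. *)
Definition hyp_param {m : nat} (h : hyp m.+1)
    (q : 'rV['F_2]_m.+1 * 'M['F_2]_(m, m.+1)) (D : 'M['F_2]_(m.+1, m)) : Prop :=
  [/\ dot q.1 h.1 = h.2, q.2 *m h.1 = 0, q.2 *m D = 1%:M
    & forall x, dot x h.1 = 0 -> x *m D *m q.2 = x].

Lemma row_basis_exists (F : fieldType) l n r (A : 'M[F]_(l, n)) :
  \rank A = r -> exists2 B : 'M[F]_(r, n), row_free B & (B :=: A)%MS.
Proof.
by move=> <-; exists (row_base A); [apply: row_base_free|apply: eq_row_base].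
Qed.

Lemma hyp_param_exists m (h : hyp m.+1) : h.1 != 0 ->
  exists q D, hyp_param h q D.
Proof.
case: h => L c /= L0; have [e eL] := dot_neq0 L0.
have rL : \rank L = 1%N.
  by apply/eqP; rewrite eqn_leq rank_leq_col lt0n mxrank_eq0.
have rK : \rank (kermx L) = m by rewrite mxrank_ker rL subn1.
have [C fC CK] := row_basis_exists rK.
exists (c *: e, C), (pinvmx C); split => //=.
- by rewrite dotZl eL mulr1.
- by apply/sub_kermxP; rewrite CK.
- exact: mulmxVp.
- move=> x xL; rewrite mulmxKpV // CK; apply/sub_kermxP.
  by rewrite [x *m L]mx11_scalar -/(dot x L) xL raddf0.
Qed.

Definition frames (k n : nat) : {set 'rV['F_2]_n * 'M['F_2]_(k, n)} :=
  [set p | row_free p.2].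

(** The sum over all of [F_2^k] is the coefficient of the top monomial, so it is nonzero exactly
    when the restriction has degree [k]. *)
Definition rejects {n : nat} (k : nat) (f : 'rV['F_2]_n -> 'F_2) :
    {set 'rV['F_2]_n * 'M['F_2]_(k, n)} :=
  [set p in frames k n | \sum_y f (affine_map p.1 p.2 y) != 0].

Definition lift_frame {n m k : nat} (q : 'rV['F_2]_n * 'M['F_2]_(m, n))
    (p : 'rV['F_2]_m * 'M['F_2]_(k, m)) : 'rV['F_2]_n * 'M['F_2]_(k, n) :=
  (affine_map q.1 q.2 p.1, p.2 *m q.2).

Lemma lift_frame_inj n m k (q : 'rV['F_2]_n * 'M['F_2]_(m, n)) :
  row_free q.2 -> injective (@lift_frame n m k q).
Proof.
move=> fq [v B] [v' B'] [/addrI /(row_free_inj fq) -> EB].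
congr (_, _); apply/row_matrixP => i.
by apply: (row_free_inj fq); rewrite -!row_mul EB.
Qed.

Lemma card_lift_frame m k (h : hyp m.+1) q D
    (S : {set 'rV['F_2]_m.+1 * 'M['F_2]_(k, m.+1)}) :
  hyp_param h q D ->
  #|[set p | lift_frame q p \in S]| =
  #|[set p in S | on_hyp h p.1 && (p.2 *m h.1 == 0)]|.
Proof.
move=> [q1 q2 q3 q4].
have inj : injective (@lift_frame m.+1 m k q).
  by apply: lift_frame_inj; apply/row_freeP; exists D.
rewrite -(card_imset _ inj); apply: eq_card => -[v B]; apply/imsetP/idP.
  move=> [[u A]]; rewrite inE => pS ->; rewrite inE pS /=.
  rewrite -mulmxA q2 mulmx0 eqxx andbT /on_hyp /affine_map dotDl q1.
  by rewrite /dot -mulmxA q2 mulmx0 mxE addr0.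
rewrite inE /= => /and3P[pS /eqP hv /eqP hB].
have BE : B *m D *m q.2 = B.
  apply/row_matrixP => i; rewrite !row_mul q4 //.
  by rewrite /dot -row_mul hB row0 mxE.
have vE : q.1 + (v - q.1) *m D *m q.2 = v.
  by rewrite q4 1?addrC ?subrK // row_oppr dotDl hv q1 F2_addxx.
exists ((v - q.1) *m D, B *m D); last by rewrite /lift_frame /= BE /affine_map vE.
by rewrite inE /lift_frame /= BE /affine_map vE.
Qed.

(** A frame [(v, B)] lies in [2^(m+1-k) - 1] genuine hyperplanes: the normal is any nonzero [L] with
    [B *m L = 0], and the constant must be [dot v L]. *)
Lemma sum_lift_frame m k (q : hyp m.+1 -> _) (D : hyp m.+1 -> _)
    (S : {set 'rV['F_2]_m.+1 * 'M['F_2]_(k, m.+1)}) :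
  (k <= m)%N -> (forall h, h.1 != 0 -> hyp_param h (q h) (D h)) ->
  S \subset frames k m.+1 ->
  (\sum_(h : hyp m.+1 | h.1 != 0%R) #|[set p | lift_frame (q h) p \in S]| =
   (2 ^ (m.+1 - k) - 1) * #|S|)%N.
Proof.
move=> km hq Sfr.
rewrite (eq_bigr (fun h => \sum_(p in S | on_hyp h p.1 && (p.2 *m h.1 == 0%R)) 1)%N);
  last by move=> h /hq/card_lift_frame ->; rewrite sum1dep_card.
rewrite (exchange_big_dep (mem S)) /=; last by move=> h p _ /andP[].
rewrite mulnC -sum_nat_const; apply: eq_bigr => -[v B] pS /=.
have fB : row_free B by have := subsetP Sfr _ pS; rewrite inE.
have kE : #|[set L : 'cV['F_2]_m.+1 | B *m L == 0]| = (2 ^ (m.+1 - k))%N.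
  apply/eqP; rewrite -(eqn_pmul2l (m := 2 ^ k)) ?expn_gt0 // card_row_free_ker //.
  by rewrite -expnD subnKC // leqW.
rewrite -kE (cardsD1 0) inE mulmx0 eqxx addKn sum1dep_card.
have inj : injective (fun L : 'cV['F_2]_m.+1 => (L, dot v L) : hyp m.+1).
  by move=> L L' [].
rewrite -(card_imset _ inj); apply: eq_card => -[L c].
rewrite inE /= /on_hyp /=; apply/idP/imsetP.
  by move=> /and3P[L0 _ /andP[/eqP<- BL]]; exists L; rewrite ?inE ?L0.
by move=> [M]; rewrite !inE => /andP[M0 BM] [-> ->]; rewrite M0 pS eqxx.
Qed.

Lemma frames_gt0 k n : (k <= n)%N -> (0 < #|frames k n|)%N.
Proof.
move=> kn; apply/card_gt0P; exists (0, pid_mx k).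
by rewrite inE /row_free rank_pid_mx.
Qed.

Lemma card_hyps n : (#|[set h : hyp n | h.1 != 0%R]| = 2 * (2 ^ n - 1))%N.
Proof.
have -> : [set h : hyp n | h.1 != 0] = setX [set~ 0] [set: 'F_2].
  by apply/setP => -[L c]; rewrite !inE andbT.
rewrite cardsX cardsT card_Fp // cardsC1 card_mx card_Fp // muln1 mulnC.
by rewrite subn1.
Qed.

Definition phi (R : realType) {n : nat} (k : nat) (f : 'rV['F_2]_n -> 'F_2) : R :=
  #|rejects k f|%:R / #|frames k n|%:R.

(** The double count is applied to [rejects] and to [frames]; the factor [2^(m+1-k) - 1] is common
    to both and cancels. *)
Lemma phi_avg (R : realType) m k (f : 'rV['F_2]_m.+1 -> 'F_2) : (k <= m)%N ->
  exists (q : hyp m.+1 -> _) (D : hyp m.+1 -> _),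
    (forall h, h.1 != 0 -> hyp_param h (q h) (D h)) /\
    \sum_(h : hyp m.+1 | h.1 != 0) phi R k (f \o affine_map (q h).1 (q h).2) =
    phi R k f * (2 * (2 ^+ m.+1 - 1)).
Proof.
move=> km.
have [q /fin_all_exists[D hq]] : exists q, forall h : hyp m.+1, exists D,
    h.1 != 0 -> hyp_param h (q h) D.
  apply: (@fin_all_exists _ (fun=> _) (fun h q =>
    exists D, h.1 != 0 -> hyp_param h q D)) => h.
  have [h0|h0] := boolP (h.1 != 0); last by exists (0, 0), 0.
  by have [q [D hq]] := hyp_param_exists h0; exists q, D.
exists q, D; split => //.
have fr (h : hyp m.+1) : h.1 != 0 ->
    [set p | lift_frame (q h) p \in frames k m.+1] = frames k m.
  move=> /hq[_ _ qD _]; apply/setP => p; rewrite !inE /= /row_free mxrankMfree //.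
  by apply/row_freeP; exists (D h).
have rj (h : hyp m.+1) : h.1 != 0 -> [set p | lift_frame (q h) p \in rejects k f] =
    rejects k (f \o affine_map (q h).1 (q h).2).
  move=> h0; apply/setP => p.
  have := congr1 (fun A : {set _} => p \in A) (fr h h0); rewrite inE in_set => Ep.
  rewrite [in RHS]in_set -Ep inE inE; congr (_ && (_ != _)).
  apply: eq_bigr => y _ /=; congr f.
  by rewrite /affine_map /= mulmxDl !mulmxA addrA.
have Er : (\sum_(h : hyp m.+1 | h.1 != 0%R)
      #|rejects k (f \o affine_map (q h).1 (q h).2)| =
    (2 ^ (m.+1 - k) - 1) * #|rejects k f|)%N.
  rewrite -(sum_lift_frame km hq); last by apply/subsetP => p; rewrite inE => /andP[].
  by apply: eq_bigr => h /rj ->.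
have Ef : (2 * (2 ^ m.+1 - 1) * #|frames k m| =
    (2 ^ (m.+1 - k) - 1) * #|frames k m.+1|)%N.
  rewrite -(sum_lift_frame km hq) // -card_hyps -sum_nat_const big_set.
  by apply: eq_bigr => h /fr ->.
rewrite /phi -mulr_suml -natr_sum Er natrM.
have /(congr1 (fun i => i%:R : R)) := Ef.
rewrite !natrM !natrB ?expn_gt0 // !natrX => {}Ef.
have Tm0 : #|frames k m|%:R != 0 :> R by rewrite pnatr_eq0 -lt0n frames_gt0.
have T0 : #|frames k m.+1|%:R != 0 :> R.
  by rewrite pnatr_eq0 -lt0n frames_gt0 // leqW.
by apply: (mulIf Tm0); rewrite mulfVK // -[RHS]mulrA Ef [RHS]mulrCA mulfVK.
Qed.

(* With more than [2^m] such hyperplanes, [f] would differ from the stitched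
   polynomial in a single point, which no hyperplane of [H] could contain. *)
Lemma few_low_hyps m d (f : 'rV['F_2]_m -> 'F_2) (H : {set hyp m}) :
  (d.+1 < m)%N -> ~~ vanish d.+1 f ->
  {in H, forall h, exists P, close d f 0 h P} -> (#|H| <= 2 ^ m)%N.
Proof.
move=> dm nf hH; rewrite leqNgt; apply/negP => lt.
have [|Q [P [s [vQ cP si [sm [sH QE]]]]]] := close_stitch hH _ lt.
  by rewrite muln0 expn_gt0.
have fP h x : h \in H -> on_hyp h x -> f x = P h x.
  move=> /cP/andP[_]; rewrite leqn0 cards_eq0 => /eqP/setP/(_ x).
  by rewrite !inE => e hx; move: e; rewrite hx => /negbFE/eqP.
set out := [set x | all (fun h => ~~ on_hyp h x) s].
have out1 : #|out| = 1%N.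
  apply/eqP; rewrite -(eqn_pmul2l (m := 2 ^ m)) ?expn_gt0 // muln1.
  by rewrite -[X in _ == X](card_outside si) sm.
have fQ x : x \notin out -> f x = Q x.
  rewrite inE -has_predC => /hasP[h hs /negPn hx].
  by rewrite (QE h hs x hx) (fP h x) // sH.
have [x0 fx0] : exists x0, f x0 != Q x0.
  apply/existsP; apply: contraNT nf; rewrite negb_exists => /forallP e.
  by rewrite (@eq_vanish _ _ _ Q) // => x; apply/eqP; have := e x; rewrite negbK.
(* Cut off to [h], the difference [P h - Q] has degree at most [d+1 < m], too low for a support
   inside the single point of [out]. *)
have notin h : h \in H -> ~~ on_hyp h x0.
  move=> hH'; apply/negP => hx0.
  pose g x := (on_hyp h x)%:R * (P h x - Q x).
  have vg : vanish d.+2 g.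
    by apply: vanish_on_hyp; apply: vanishB => //; have /andP[] := cP h hH'.
  have gx0 : g x0 != 0 by rewrite /g hx0 mul1r subr_eq0 -(fP _ _ hH' hx0).
  have sub : [set x | g x != 0] \subset out.
    apply/subsetP => x; rewrite inE; apply: contraNT => /fQ fQx.
    rewrite /g; have [hx|] := boolP (on_hyp h x); last by rewrite mul0r.
    by rewrite -(fP _ _ hH' hx) fQx subrr mulr0.
  have := leq_trans (vanish_support vg gx0)
            (leq_mul (leqnn _) (subset_leq_card sub)).
  by rewrite out1 muln1 leq_exp2l // leqNgt dm.
(* A hyperplane avoiding [x0] is determined by its normal. *)
have sub : H \subset [set (L, dot x0 L + 1) | L : 'cV['F_2]_m].
  apply/subsetP => -[L c] /notin /hyp_eqF /= e; apply/imsetP; exists L => //.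
  by rewrite e -addrA F2_addxx addr0.
have := leq_trans lt (leq_trans (subset_leq_card sub) (leq_imset_card _ _)).
by rewrite card_mx card_Fp // muln1 ltnn.
Qed.

(** [P] extends to the whole space by composition with the affine map [r], which on [h] inverts the
    parametrization. *)
Lemma close_of_restriction m d b (f : 'rV['F_2]_m.+1 -> 'F_2) h q D
    (P : 'rV['F_2]_m -> 'F_2) :
  hyp_param h q D -> vanish d.+1 P ->
  (#|[set z | (f \o affine_map q.1 q.2) z != P z]| <= b)%N ->
  exists P', close d f b h P'.
Proof.
move=> [q1 q2 q3 q4] vP le.
pose r := affine_map (- q.1 *m D) D.
exists [ffun x => P (r x)]; rewrite /close.
rewrite (@eq_vanish _ _ _ (P \o r)) => [|x]; last by rewrite ffunE.
rewrite vanish_affine //=; apply: leq_trans le.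
apply: (@leq_trans
  #|affine_map q.1 q.2 @: [set z | (f \o affine_map q.1 q.2) z != P z]|);
  last exact: leq_imset_card.
apply/subset_leq_card/subsetP => x; rewrite inE ffunE => /andP[/eqP hx fx].
have d0 : dot (- q.1 + x) h.1 = 0 by rewrite row_oppr dotDl hx q1 F2_addxx.
have E : affine_map q.1 q.2 (r x) = x.
  by rewrite /r /affine_map -mulmxDl (q4 _ d0) addrA subrr add0r.
by apply/imsetP; exists (r x); rewrite // inE /= E.
Qed.

Lemma phi_ge0 (R : realType) n k (f : 'rV['F_2]_n -> 'F_2) : 0 <= phi R k f.
Proof. by rewrite divr_ge0 ?ler0n. Qed.

(** [H] collects the exceptional hyperplanes, for which only [phi >= 0] is used. *)
Lemma phi_avg_ge (R : realType) m k (f : 'rV['F_2]_m.+1 -> 'F_2) (c : R)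
    (H : {set hyp m.+1}) : (k <= m)%N -> 0 <= c ->
  (forall h q D, h \notin H -> hyp_param h q D ->
     c <= phi R k (f \o affine_map q.1 q.2)) ->
  (2 * (2 ^+ m.+1 - 1) - #|H|%:R) * c <= phi R k f * (2 * (2 ^+ m.+1 - 1)).
Proof.
move=> km c0 hc; have [q [D [hq <-]]] := phi_avg R f km.
have -> : 2 * (2 ^+ m.+1 - 1) = \sum_(h : hyp m.+1 | h.1 != 0) 1 :> R.
  rewrite -big_set sumr_const card_hyps natrM natrB ?expn_gt0 //.
  by rewrite natrX.
rewrite mulrBl lerBlDr !mulr_suml.
apply: (@le_trans _ _ (\sum_(h : hyp m.+1 | h.1 != 0)
    (phi R k (f \o affine_map (q h).1 (q h).2) + (h \in H)%:R * c))).
  apply: ler_sum => h h0; rewrite mul1r; have [_|hH] := boolP (h \in H).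
    by rewrite mul1r lerDr phi_ge0.
  by rewrite mul0r addr0; apply: hc hH (hq h h0).
rewrite big_split /= lerD2l -mulr_suml ler_wpM2r // -natr_sum ler_nat -sum1_card.
rewrite [X in (X <= _)%N]big_mkcond [X in (_ <= X)%N]big_mkcond /=.
by apply: leq_sum => h _; do 2!case: ifP.
Qed.

(** * Lower bound in small dimensions *)

(** In dimension [k] every frame is an affine bijection of the whole space, so all frames see the
    same sum; were it zero, [vanish_sum] would apply. *)
Lemma phi_full (R : realType) k (f : 'rV['F_2]_k -> 'F_2) :
  ~~ vanish k f -> phi R k f = 1.
Proof.
move=> nf.
have sumE v (B : 'M_k) : row_free B ->
    \sum_y f (affine_map v B y) = \sum_y f y.
  move=> fB; rewrite [RHS](reindex_inj (h := affine_map v B)) // => y y'.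
  by move/addrI/(row_free_inj fB).
have s0 : \sum_y f y != 0.
  apply: contra nf => /eqP s0; apply: vanish_sum => v B.
  have [/sumE->//|/sum_not_row_free->//] := boolP (row_free B).
rewrite /phi; have -> : rejects k f = frames k k.
  apply/setP => p; rewrite inE andb_idr // inE => /sumE ->; exact: s0.
by rewrite divff // pnatr_eq0 -lt0n frames_gt0.
Qed.

(** With [X = 2^(m+1)], at most [X] of the [2 * (X - 1)] hyperplanes make the degree drop to [d].
    Since [X >= 4], at least a quarter remain, so each dimension costs a factor 4. *)
Lemma phi_descent (R : realType) d j (f : 'rV['F_2]_(j + d.+1) -> 'F_2) :
  ~~ vanish d.+1 f -> 4^-1 ^+ j <= phi R d.+1 f.
Proof.
elim: j f => [|j IH] f nf; first by rewrite (phi_full _ nf).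
set m := (j + d.+1)%N in f nf IH *.
pose H := [set h : hyp m.+1 | [exists P, close d f 0 h P]].
have cH : (#|H| <= 2 ^ m.+1)%N.
  apply: (few_low_hyps (d := d) (f := f)) => //; first by rewrite ltnS leq_addl.
  by move=> h; rewrite inE => /existsP.
have := @phi_avg_ge R m d.+1 f (4^-1 ^+ j) H (leq_addl _ _).
have c0 : 0 <= 4^-1 ^+ j :> R by rewrite exprn_ge0 // invr_ge0.
move=> /(_ c0) h; rewrite exprSr.
have {h} : (2 * (2 ^+ m.+1 - 1) - #|H|%:R) * 4^-1 ^+ j <=
    phi R d.+1 f * (2 * (2 ^+ m.+1 - 1)).
  apply: h => h q D; rewrite inE => hH hq; apply: IH.
  apply: contra hH => v0; apply/existsP.
  apply: (close_of_restriction hq v0).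
  by rewrite leqn0 cards_eq0; apply/eqP/setP => z; rewrite !inE eqxx.
have : #|H|%:R <= 2 ^+ m.+1 :> R by rewrite -natrX ler_nat.
have : 4 <= 2 ^+ m.+1 :> R 
    by rewrite (_ : 4 = (2 ^ 2)%:R) // -natrX ler_nat leq_exp2l // ltnS /m addnS.
move: c0; set c := _ ^+ j; set X := _ ^+ _; set K := _%:R; set p := phi _ _ _.
move=> c0 X4 KX le.
have X0 : 0 < 2 * (X - 1) by lra.
rewrite -(ler_pM2r X0); apply: le_trans le; nra.
Qed.

(** * Second moment bound near degree [d] *)

Lemma card_affine_hit n k (D : {set 'rV['F_2]_n}) (y : 'rV['F_2]_k) :
  #|[set p : 'rV_n * 'M_(k, n) | affine_map p.1 p.2 y \in D]| =
  (#|D| * 2 ^ (k * n))%N.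
Proof.
rewrite -sum1dep_card (eq_bigl (fun p : 'rV['F_2]_n * 'M_(k, n) =>
  true && (affine_map p.1 p.2 y \in D))) //.
rewrite -(pair_big_dep predT (fun v (B : 'M_(k, n)) => affine_map v B y \in D)
  (fun _ _ => 1%N)) /= (exchange_big_dep predT) //=.
rewrite (eq_bigr (fun=> #|D|)) => [|B _].
  by rewrite sum_nat_const card_mx card_Fp // mulnC.
rewrite sum1dep_card -(card_preimset D (addIr (y *m B))).
by apply: eq_card => v; rewrite !inE.
Qed.

Lemma card_mul_row n k (z : 'rV['F_2]_k) (w : 'rV['F_2]_n) : z != 0 ->
  (2 ^ n * #|[set B : 'M_(k, n) | z *m B == w]| = 2 ^ (k * n))%N.
Proof.
move=> z0; rewrite -[n in (2 ^ n)%N]mul1n; apply: card_fiber => [B C|u].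
  by rewrite mulmxDr.
have : row_free z by rewrite /row_free rank_rV z0.
by move=> /row_freeP[C zC]; exists (C *m u); rewrite mulmxA zC mul1mx.
Qed.

(** Pairwise independence: under a random affine map, two distinct parameters have independent
    uniform images. *)
Lemma card_affine_hit2 n k (D : {set 'rV['F_2]_n}) (y y' : 'rV['F_2]_k) :
  y != y' ->
  (2 ^ n * #|[set p : 'rV_n * 'M_(k, n) |
    (affine_map p.1 p.2 y \in D) && (affine_map p.1 p.2 y' \in D)]| =
  #|D| ^ 2 * 2 ^ (k * n))%N.
Proof.
move=> yy'; pose z := y' - y; have z0 : z != 0 by rewrite subr_eq0 eq_sym.
(* This change of variables makes the image of [y] the base point [v], and that of [y'] the point
   [v + z *m B]. *)
pose g (p : 'rV['F_2]_n * 'M['F_2]_(k, n)) := (p.1 - y *m p.2, p.2).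
have gi : injective g.
  by move=> [v B] [v' B'] [/[swap] -> /addIr ->].
rewrite -(card_preimset _ gi).
rewrite (_ : _ @^-1: _ = [set p : 'rV_n * 'M_(k, n) |
    (p.1 \in D) && (affine_map p.1 p.2 z \in D)]); last first.
  apply/setP => -[v B]; rewrite !inE /g /affine_map /= subrK /z mulmxBl.
  by rewrite addrA addrAC.
rewrite -sum1dep_card.
rewrite -(pair_big_dep (mem D) (fun v (B : 'M_(k, n)) => affine_map v B z \in D)
  (fun _ _ => 1%N)) /= big_distrr /= -mulnn -mulnA -sum_nat_const.
apply: eq_bigr => v _.
rewrite (partition_big (fun B : 'M_(k, n) => affine_map v B z) (mem D)) //=.
rewrite big_distrr /= -sum_nat_const; apply: eq_bigr => x xD.
rewrite sum1dep_card -(card_mul_row (x - v) z0); congr (_ * _)%N.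
apply: eq_card => B; rewrite !inE /affine_map.
have -> : (z *m B == x - v) = (v + z *m B == x).
  by rewrite eq_sym subr_eq addrC eq_sym.
by rewrite andb_idl // => /eqP ->.
Qed.

(** The number of points of [D] hit by a random affine map has mean [mu = 2^(d+1) * delta] and
    second moment at most [mu + mu^2]. Exactly one is hit with probability at least
    [2 mu - (mu + mu^2)], which is at least [mu/2] because [mu <= 1/2]. *)
Lemma phi_small (R : realType) n d (f P : 'rV['F_2]_n -> 'F_2) :
  (d < n)%N -> vanish d.+1 P -> (2 ^ d.+2 * #|[set x | (f x != P x)%R]| <= 2 ^ n)%N ->
  2 ^+ d * (#|[set x | f x != P x]|%:R / 2 ^+ n) <= phi R d.+1 f.
Proof.
set D := [set x | _] => dn vP small; set k := d.+1 in vP *.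
pose hits (p : 'rV['F_2]_n * 'M['F_2]_(k, n)) := [set y | affine_map p.1 p.2 y \in D].
have rej p : #|hits p| = 1%N -> p \in rejects k f.
  move=> /eqP/cards1P[y hy].
  have s1 : \sum_y f (affine_map p.1 p.2 y) = 1.
    have -> : \sum_y f (affine_map p.1 p.2 y) =
        \sum_y (f (affine_map p.1 p.2 y) - P (affine_map p.1 p.2 y)).
      by rewrite sumrB (sum_vanish p.1 p.2 vP) subr0.
    rewrite (bigD1 y) //= big1 => [|y' yy'].
      have : y \in hits p by rewrite hy set11.
      by rewrite inE inE addr0 -subr_eq0 F2_neq0 => /eqP.
    have : y' \notin hits p by rewrite hy inE.
    by rewrite inE inE negbK -subr_eq0 => /eqP.
  (* A degenerate parametrization has sum zero, so a single hit forces a genuine frame. *)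
  rewrite inE inE s1 oner_neq0 andbT; apply: contraT => nfr.
  by move: s1; rewrite (sum_not_row_free _ _ nfr) => /eqP; rewrite eq_sym oner_eq0.
have hitsE p : #|hits p| = (\sum_(y : 'rV_k) (affine_map p.1 p.2 y \in D))%N.
  by rewrite -sum1dep_card big_mkcond.
have S1 : (\sum_p #|hits p| = 2 ^ k * (#|D| * 2 ^ (k * n)))%N.
  under eq_bigr do rewrite hitsE.
  rewrite exchange_big /= (eq_bigr (fun=> #|D| * 2 ^ (k * n))%N) => [|y _].
    by rewrite sum_nat_const card_mx card_Fp // mul1n.
  by rewrite -(card_affine_hit D y) -sum1dep_card [RHS]big_mkcond.
have S2 : (2 ^ n * \sum_p #|hits p| ^ 2 <=
    2 ^ n * (2 ^ k * (#|D| * 2 ^ (k * n))) +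
    2 ^ k * (2 ^ k * (#|D| ^ 2 * 2 ^ (k * n))))%N.
  under eq_bigr do rewrite hitsE -mulnn big_distrlr /=.
  rewrite exchange_big /=; under eq_bigr do rewrite exchange_big /=.
  have c : #|'rV['F_2]_k| = (2 ^ k)%N by rewrite card_mx card_Fp // mul1n.
  apply: (@leq_trans (\sum_(y : 'rV['F_2]_k) (2 ^ n * (#|D| * 2 ^ (k * n)) +
      \sum_(y' : 'rV['F_2]_k) #|D| ^ 2 * 2 ^ (k * n)))%N); last first.
    by rewrite big_split /= !sum_nat_const c mulnCA.
  rewrite big_distrr /=; apply: leq_sum => y _; rewrite (bigD1 y) //= mulnDr leq_add //.
    rewrite -(card_affine_hit D y) -sum1dep_card [X in (_ <= _ * X)%N]big_mkcond /=.
    by rewrite leq_mul2l leq_sum ?orbT // => p _; case: (_ \in D).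
  rewrite big_distrr /= [X in (_ <= X)%N](bigID (predC1 y)) /=.
  apply: leq_trans (leq_addr _ _); apply: leq_sum => y' yy'.
  rewrite -(card_affine_hit2 D (y := y) (y' := y')) 1?eq_sym // leq_mul2l.
  rewrite -sum1dep_card [X in (_ <= X)%N]big_mkcond leq_sum ?orbT // => p _.
  by do 2!case: (_ \in D).
(* Pointwise, [2h <= h^2 + [h = 1]] for every natural number [h]. *)
have S3 : (2 * \sum_p #|hits p| <= \sum_p #|hits p| ^ 2 + #|rejects k f|)%N.
  rewrite -sum1_card [X in (_ <= _ + X)%N]big_mkcond /= -big_split big_distrr /=.
  apply: leq_sum => p _; have := rej p.
  case: #|hits p| => [|[|a]] //= h; first by rewrite h.
  by rewrite (leq_trans _ (leq_addr _ _)) // -mulnn leq_mul2r.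
have frE : (#|frames k n| <= 2 ^ n * 2 ^ (k * n))%N.
  by rewrite (leq_trans (max_card _)) // card_prod !card_mx card_Fp // mul1n.
have rE : (2 ^ d * #|D| * 2 ^ (k * n) <= #|rejects k f|)%N.
  have A0 : (0 < 2 ^ n)%N by rewrite expn_gt0.
  rewrite -(leq_pmul2l A0).
  move: small S1 S2 S3; rewrite /k !expnS.
  set A := (2 ^ n)%N in A0 *; set K := (2 ^ d)%N; set M := (2 ^ _)%N.
  set S := (\sum_p _)%N; set T := (\sum_p _)%N; set r := #|rejects _ _|.
  set a := #|D| => small -> S2 S3.
  have h1 := leq_mul2l A (2 * (2 * K * (a * M))) (T + r); rewrite S3 orbT in h1.
  have h2 := leq_mul2l (K * a * M) (2 * (2 * K) * a) A.
  rewrite small orbT in h2.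
  rewrite expn0 muln1 in S2 *; nia.
rewrite /phi ler_pdivlMr ?ltr0n ?frames_gt0 // mulrA -mulrAC ler_pdivrMr ?exprn_gt0 //.
rewrite -!natrX -!natrM ler_nat.
apply: (leq_trans (leq_mul (leqnn _) frE)).
by rewrite mulnCA mulnC leq_mul2r rE orbT.
Qed.

(** * Functions far from degree [d] *)

(** Cut off to [h0], the difference [Q - P0] has degree at most [d+1] and vanishes on all of [s].
    Its support has density at most [2^-(d+2)], below the minimum distance [2^-(d+1)]. *)
Lemma stitch_agree n d (f : 'rV['F_2]_n -> 'F_2) b (s : seq (hyp n)) P h0 P0
    (Q : 'rV['F_2]_n -> 'F_2) x :
  (2 ^ d.+2 * (b + b) < 2 ^ n)%N -> indep s -> size s = d.+2 ->
  {in s, forall h, close d f b h (P h)} -> close d f b h0 P0 ->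
  vanish d.+1 Q -> {in s, forall h, forall y, on_hyp h y -> Q y = P h y} ->
  on_hyp h0 x -> Q x = P0 x.
Proof.
move=> lt si sl cP cP0 vQ QE hx; apply/eqP; apply: contraT.
rewrite -subr_eq0 => QP.
pose g y := (on_hyp h0 y)%:R * (Q y - P0 y).
have vg : vanish d.+2 g.
  by apply: vanish_on_hyp; apply: vanishB => //; have /andP[] := cP0.
have gx : g x != 0 by rewrite /g hx mul1r.
have sub : [set y | g y != 0] \subset [set y | all (fun h => ~~ on_hyp h y) s].
  apply/subsetP => y; rewrite !inE; apply: contraNT; rewrite -has_predC.
  move=> /hasP[h hs /negPn hy]; rewrite /g (QE h hs y hy).
  have [h0y|] := boolP (on_hyp h0 y); last by rewrite mul0r.
  by rewrite (close_consistent (cP h hs) cP0 lt hy h0y) subrr mulr0.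
have := leq_trans (vanish_support vg gx)
          (leq_mul (leqnn _) (subset_leq_card sub)).
have := card_outside si; rewrite sl expnS -mulnA => <-.
by have := expn_gt0 2 n; rewrite -(card_outside si) sl expnS -mulnA; lia.
Qed.

Lemma close_of_many n d (f : 'rV['F_2]_n -> 'F_2) b (H : {set hyp n}) :
  {in H, forall h, exists P, close d f b h P} ->
  (2 ^ d.+2 * (b + b) < 2 ^ n)%N -> (2 ^ d.+2 < #|H|)%N ->
  exists Q : {ffun 'rV['F_2]_n -> 'F_2}, vanish d.+1 Q /\
    (#|H| * #|[set x | (f x != Q x)%R]| <= 3 * b * #|H| + 9 * 2 ^ n)%N.
Proof.
move=> hH lt cH.
have [Q [P [s [vQ cP si [sl [sH QE]]]]]] := close_stitch hH lt cH.
have vQf : vanish d.+1 [ffun x => Q x].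
  by rewrite (@eq_vanish _ _ _ Q) // => x; rewrite ffunE.
exists [ffun x => Q x]; split => //; apply: close_of_cover => h hH'.
have /andP[_] := cP h hH'; apply: leq_trans.
apply/subset_leq_card/subsetP => x; rewrite !inE ffunE => /andP[fx hx].
rewrite hx /= -(stitch_agree lt si sl _ (cP h hH') vQ QE hx) //.
by move=> h' /sH/cP.
Qed.

(* The threshold [1/24] lies below [1/4], where [phi_small] stops applying; the
   gap pays for the loss in [close_of_many]. *)
Definition far {n : nat} (d : nat) (f : 'rV['F_2]_n -> 'F_2) : Prop :=
  forall P : {ffun 'rV['F_2]_n -> 'F_2}, vanish d.+1 P ->
    (2 ^ n <= 24 * 2 ^ d * #|[set x | (f x != P x)%R]|)%N.

Lemma far_not_vanish n d (f : 'rV['F_2]_n -> 'F_2) : far d f -> ~~ vanish d.+1 f.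
Proof.
move=> ff; apply/negP => vf.
have := ff [ffun x => f x]; rewrite (@eq_vanish _ _ _ f) => [|x]; last by rewrite ffunE.
move=> /(_ vf); rewrite (_ : [set x | _] = set0) ?cards0 ?muln0 ?leqn0 ?expn_eq0 //.
by apply/setP => x; rewrite !inE ffunE eqxx.
Qed.

(* The term [144 * 2^(d-n)] absorbs the loss of a factor [1 - 36 * 2^(d-n)] when
   passing from dimension [n] to dimension [n+1]. *)
Lemma phi_far (R : realType) d j (f : 'rV['F_2]_(j + (7 + d.+1)) -> 'F_2) :
  far d f -> 4^-1 ^+ 8 * (1 + 144 * 2^-1 ^+ (j + 8)) <= phi R d.+1 f.
Proof.
elim: j f => [|j IH] f ff.
  (* The descent gives [4^-7], enough because [1 + 144/256 < 4]. *)
  apply: le_trans (phi_descent R (j := 7) (far_not_vanish ff)).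
  by rewrite !exprS expr0; lra.
set m := (j + (7 + d.+1))%N in f ff IH *.
have mE : (2 ^ m = 2 ^ d * 2 ^ (j + 8))%N.
  by rewrite -expnD; congr (2 ^ _)%N; rewrite /m; lia.
(* The largest number of disagreements that [far] forbids in dimension [m]. *)
pose b := ((2 ^ m - 1) %/ (24 * 2 ^ d))%N.
have bE x : (x <= b)%N = (24 * 2 ^ d * x < 2 ^ m)%N.
  rewrite leq_divRL ?muln_gt0 ?expn_gt0 // mulnC.
  by have := expn_gt0 2 m; case: (2 ^ m)%N => // k _; rewrite subn1.
have bb : (24 * 2 ^ d * b < 2 ^ m)%N by rewrite -bE.
pose H := [set h : hyp m.+1 | [exists P, close d f b h P]].
have [few|many] := leqP #|H| (72 * 2 ^ d).
  have t0 : 0 <= 2^-1 ^+ (j + 8) :> R by rewrite exprn_ge0 // invr_ge0.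
  have e0 : 0 <= 4^-1 ^+ 8 :> R by rewrite exprn_ge0 // invr_ge0.
  have c0 : 0 <= 4^-1 ^+ 8 * (1 + 144 * 2^-1 ^+ (j + 8)) :> R.
    by rewrite mulr_ge0 // addr_ge0 // mulr_ge0.
  have dm : (d.+1 <= m)%N by rewrite /m; lia.
  have := @phi_avg_ge R m d.+1 f _ H dm c0.
  have {}IH h q D : h \notin H -> hyp_param h q D ->
      4^-1 ^+ 8 * (1 + 144 * 2^-1 ^+ (j + 8)) <= phi R d.+1 (f \o affine_map q.1 q.2).
    move=> hH hq; apply: IH => P vP; rewrite leqNgt; apply: contra hH.
    rewrite -bE inE => le; apply/existsP; exact: close_of_restriction hq vP le.
  move=> /(_ IH); rewrite addSn (exprS 2^-1).
  have t1 : 2^-1 ^+ (j + 8) <= 256^-1 :> R.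
    rewrite exprD (le_trans (ler_piMl _ _)) ?exprn_ge0 ?exprn_ile1 ?invr_ge0 //.
      by rewrite invf_le1 ?ler1n.
    by rewrite !exprS expr0; lra.
  have mR : 2 ^+ m * 2^-1 ^+ (j + 8) = 2 ^+ d :> R.
    rewrite -natrX mE natrM !natrX -mulrA -exprMn divff ?expr1n ?mulr1 //.
    by rewrite pnatr_eq0.
  have few' : #|H|%:R <= 72 * 2 ^+ d :> R.
    by rewrite -natrX -natrM ler_nat.
  have m1 : 1 <= 2 ^+ m :> R by rewrite exprn_ege1 ?ler1n.
  move: t0 e0 t1 mR few' m1 {c0 IH}; rewrite [2 ^+ m.+1]exprS.
  set t := 2^-1 ^+ _; set e := 4^-1 ^+ _; set X := 2 ^+ m; set D := 2 ^+ d.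
  set K := #|H|%:R; set p := phi _ _ _ => t0 e0 t1 XD KD X1 le.
  clearbody t e; have Y0 : 0 < 2 * (2 * X - 1) by lra.
  rewrite -(ler_pM2r Y0); apply: le_trans le.
  rewrite -!mulrA [X in _ <= X]mulrCA ler_wpM2l //.
  have KY : K <= 36 * t * (2 * (2 * X - 1)) by nra.
  move: Y0 KY; set Y := 2 * (_ - 1) => Y0 KY.
  have : (Y - 36 * t * Y) * (1 + 144 * t) <= (Y - K) * (1 + 144 * t).
    by apply: ler_wpM2r; lra.
  (* This is [Y] times the slack in [(1 - 36t)(1 + 144t) >= 1 + 72t], nonnegative because
     [t <= 1/256]. *)
  have : 0 <= Y * (t * (36 - 5184 * t)).
    by apply: mulr_ge0; [|apply: mulr_ge0]; lra.
  lra.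
have [] := @close_of_many m.+1 d f b H.
- by move=> h; rewrite inE => /existsP.
- by rewrite !expnS; lia.
- by apply: leq_ltn_trans many; rewrite !expnS; lia.
move=> Q [vQ le]; have far_Q := ff Q vQ.
apply: le_trans (phi_small R _ vQ _).
- have : 2 ^+ m.+1 <= 24 * 2 ^+ d * #|[set x | f x != Q x]|%:R :> R.
    by rewrite -!natrX -!natrM ler_nat.
  have N0 : 0 < 2 ^+ m.+1 :> R by rewrite exprn_gt0.
  have t1 : 2^-1 ^+ (j.+1 + 8) <= 1 :> R.
    by rewrite exprn_ile1 ?invr_ge0 // invf_le1 ?ler1n.
  rewrite mulrA ler_pdivlMr //.
  have : 4^-1 ^+ 8 * (1 + 144 * 2^-1 ^+ (j.+1 + 8)) <= 24^-1 :> R.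
    by rewrite !(exprS 4^-1) expr0; lra.
  move=> /(ler_wpM2r (ltW N0)) h1 h2; apply: le_trans h1 _.
  by rewrite mulrC ler_pdivrMr // [X in _ <= X]mulrC mulrA.
- by rewrite /m; lia.
(* It remains to see [4 * D * a <= 2 * M]: the disagreements on hyperplanes contribute at most
   [M/2], since [24 * D * b <= M], and the rarely covered points at most [M], since
   [72 * D <= K]. *)
have K0 : (0 < #|H|)%N by apply: leq_ltn_trans many.
rewrite -(leq_pmul2l K0).
move: le bb many K0; rewrite !expnS.
set K := #|H|; set D := (2 ^ d)%N; set M := (2 ^ m)%N.
set a := #|[set x | _]| => le bb many K0.
have h1 := leq_mul2l (4 * D) (K * a) (3 * b * K + 9 * (2 * M)).
rewrite le orbT in h1.
have h2 := leq_mul2l K (24 * D * b) M; rewrite (ltnW bb) orbT in h2.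
have h3 := leq_mul2l M (72 * D) K; rewrite (ltnW many) orbT in h3.
lia.
Qed.

(** * From frames to random flats *)

Definition flat_of {n k : nat} (p : 'rV['F_2]_n * 'M['F_2]_(k, n)) :
    {set 'rV['F_2]_n} := [set affine_map p.1 p.2 y | y : 'rV['F_2]_k].

Lemma mem_flat_of n k (p : 'rV['F_2]_n * 'M['F_2]_(k, n)) x :
  (x \in flat_of p) = (x - p.1 <= p.2)%MS.
Proof.
apply/imsetP/submxP => [[y _ ->]|[y xE]]; exists y => //.
  by rewrite /affine_map addrC addKr.
by rewrite /affine_map -xE addrC subrK.
Qed.

Lemma flat_of_lift n m k (q : 'rV['F_2]_n * 'M['F_2]_(m, n))
    (p : 'rV['F_2]_m * 'M['F_2]_(k, m)) :
  flat_of (lift_frame q p) = affine_map q.1 q.2 @: flat_of p.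
Proof.
rewrite /flat_of -imset_comp; apply: eq_imset => y /=.
by rewrite /affine_map /= mulmxDl !mulmxA addrA.
Qed.

Lemma flat_of_flats n k p : p \in frames k n -> flat_of p \in flats k n.
Proof.
rewrite inE => fp; rewrite inE; apply/existsP; exists p.1; apply/existsP.
exists (<<p.2>>)%MS; rewrite genmxE; apply/andP; split; first exact: fp.
by apply/eqP/setP => x; rewrite mem_flat_of inE genmxE.
Qed.

Lemma flats_flat_of n k A : A \in flats k n ->
  exists2 p, p \in frames k n & flat_of p = A.
Proof.
rewrite inE => /existsP[v /existsP[U /andP[/eqP rU /eqP ->]]].
have [B fB BU] := row_basis_exists rU.
exists (v, B); first by rewrite inE.
by apply/setP => x; rewrite mem_flat_of inE BU.
Qed.

(** Relative to one frame [q] of the flat, its frames are those of [F_2^k]. Hence a uniform frame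
    yields a uniform flat. *)
Lemma card_frames_flat n k A : A \in flats k n ->
  #|[set p in frames k n | flat_of p == A]| = #|frames k k|.
Proof.
move=> /flats_flat_of[q fq <-]; have fq2 : row_free q.2 by rewrite inE in fq.
rewrite -(card_imset _ (@lift_frame_inj n k k q fq2)).
apply: eq_card => p; rewrite inE; apply/andP/imsetP => [[fp /eqP pq]|[p' fp' ->]].
  have fp2 : row_free p.2 by rewrite inE in fp.
  have v1 : (p.1 - q.1 <= q.2)%MS.
    by rewrite -mem_flat_of -pq mem_flat_of subrr sub0mx.
  have B1 : (p.2 <= q.2)%MS.
    apply/row_subP => i.
    have : p.1 + row i p.2 \in flat_of q.
      by rewrite -pq mem_flat_of addrC addKr row_sub.
    rewrite mem_flat_of addrAC => h.
    by rewrite -[row i p.2](addKr (p.1 - q.1)) addmx_sub // eqmx_opp.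
  exists ((p.1 - q.1) *m pinvmx q.2, p.2 *m pinvmx q.2).
    by rewrite inE /= /row_free -(mxrankMfree _ fq2) mulmxKpV.
  rewrite /lift_frame /affine_map /= !mulmxKpV // addrC subrK.
  by case: (p).
have fp2 : row_free p'.2 by rewrite inE in fp'.
split; first by rewrite inE /= /row_free mxrankMfree.
rewrite flat_of_lift (_ : flat_of p' = setT); last first.
  apply/setP => y; rewrite mem_flat_of !inE.
  by rewrite submx_full // row_full_unit -row_free_unit.
by apply/eqP/setP => x; apply/imsetP/imsetP => -[y _ ->]; exists y.
Qed.

Lemma affine_map_inj n k (p : 'rV['F_2]_n * 'M['F_2]_(k, n)) :
  row_free p.2 -> injective (affine_map p.1 p.2).
Proof. by move=> fp y y' /addrI /(row_free_inj fp). Qed.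

(** An accepting parametrization is injective by cardinality, so its sum is also the sum over the
    flat; [sum_deg_lt] makes it zero. *)
Lemma rejects_GN n d (f : 'rV['F_2]_n -> 'F_2) p :
  p \in rejects d.+1 f -> ~~ GN_accepts d f (flat_of p).
Proof.
rewrite !inE => /andP[fp]; apply: contra => /existsP[v /existsP[B /andP[/eqP E dE]]].
have injp := affine_map_inj fp.
have inj : {in predT &, injective (affine_map v B)}.
  apply/imset_injP; rewrite E card_imset //.
rewrite -(big_imset _ (in2W injp)) /= -/(flat_of p) -E big_imset //=.
by apply/eqP; apply: sum_deg_lt dE.
Qed.

Lemma phi_le_prob (R : realType) n d (f : 'rV['F_2]_n -> 'F_2) : (d < n)%N ->
  phi R d.+1 f <= prob_GN_rejects R d f.
Proof.
move=> dn; set k := d.+1; set M := #|frames k k|.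
have cF : #|frames k n| = (#|flats k n| * M)%N.
  rewrite -sum1_card (partition_big flat_of (mem (flats k n))) /=; last first.
    exact: flat_of_flats.
  rewrite -sum_nat_const; apply: eq_bigr => A AF.
  by rewrite sum1dep_card card_frames_flat.
have cR : (#|rejects k f| <= #|[set A in flats k n | ~~ GN_accepts d f A]| * M)%N.
  rewrite -sum1_card (partition_big flat_of
    (mem [set A in flats k n | ~~ GN_accepts d f A])) /=; last first.
    move=> p pr; rewrite inE rejects_GN // andbT flat_of_flats //.
    by move: pr; rewrite inE => /andP[].
  rewrite -sum_nat_const; apply: leq_sum => A; rewrite inE => /andP[AF _].
  rewrite sum1dep_card /M -(card_frames_flat AF) subset_leq_card //.
  by apply/subsetP => p; rewrite !inE => /andP[/andP[-> _] ->].
have M0 : (0 < M)%N by rewrite frames_gt0.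
have F0 : (0 < #|flats k n|)%N.
  by have := frames_gt0 dn; rewrite -/k cF muln_gt0 => /andP[].
rewrite /phi /prob_GN_rejects -/k cF natrM ler_pdivrMr ?mulr_gt0 ?ltr0n //.
rewrite mulrA divfK ?pnatr_eq0 -?lt0n // -natrM ler_nat.
exact: cR.
Qed.

Theorem theorem1 (R : realType) :
  exists eps1 : R, 0 < eps1 /\
    forall (d n : nat) (f : 'rV['F_2]_n -> 'F_2), (d.+1 <= n)%N ->
      Num.min (2 ^+ d * dist_RM R d f) eps1 <= prob_GN_rejects R d f.
Proof.
(* The bound of [phi_far] never drops below [4^-8], and [phi_descent] does at least as well in the
   smaller dimensions. *)
exists (4^-1 ^+ 8); split; first by rewrite exprn_gt0 // invr_gt0.
move=> d n f dn; apply: le_trans (phi_le_prob R f dn); rewrite ge_min.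
have [/existsP[P /andP[vP cP]]|nex] := boolP [exists P : {ffun 'rV['F_2]_n -> 'F_2},
    vanish d.+1 P && (2 ^ d.+2 * #|[set x | (f x != P x)%R]| <= 2 ^ n)%N].
  apply/orP; left; apply: le_trans (phi_small R dn vP cP).
  rewrite ler_pM2l ?exprn_gt0 // (@le_trans _ _ (dist R f P)) //.
    by apply: bigmin_le_cond; rewrite inE deg_vanish.
  by rewrite /dist cardsT card_mx card_Fp // mul1n natrX.
apply/orP; right.
(* No polynomial lies within [2^-(d+2)] of [f], hence none within the smaller radius of [far]. *)
have ff : far d f.
  move=> P vP; move: nex; rewrite negb_exists => /forallP/(_ P).
  by rewrite vP -ltnNge !expnS; lia.
have e1 j : (4^-1 ^+ j : R) <= 1 by rewrite exprn_ile1 ?invr_ge0 // invf_le1 ?ler1n.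
have [n8|n8] := leqP (7 + d.+1) n.
  move: f ff {nex dn}; rewrite -(subnK n8) => f ff; apply: le_trans (phi_far R ff).
  rewrite ler_peMr ?exprn_ge0 ?invr_ge0 // lerDl mulr_ge0 // exprn_ge0 //.
  by rewrite invr_ge0.
have [j nE] : exists j, n = (j + d.+1)%N by exists (n - d.+1)%N; rewrite subnK.
subst n; have j8 : (j <= 8)%N by lia.
apply: le_trans (phi_descent R (far_not_vanish ff)).
by rewrite -(subnK j8) exprD ler_piMl ?e1 // exprn_ge0 // invr_ge0.
Qed.
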